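(* For any centered Gaussian random vector $(X_1,X_2,X_3)$ (each $X_i$ real-valued with positive variance), $$E[X_1^{8}X_2^{6}X_3^{4}]\ge E[X_1^{8}]\,E[X_2^{6}]\,E[X_3^{4}],$$ and equality holds if and only if $X_1,X_2,X_3$ are independent.
   Context: All Gaussian random variables are assumed real-valued and non-degenerate (positive variance). *)

(* Defs.v *)
From HB Require Import structures.
From mathcomp Require Import all_boot all_order all_algebra.
From mathcomp Require Import all_classical all_reals all_analysis.
Set Implicit Arguments. Unset Strict Implicit. Unset Printing Implicit Defensive.
Import Order.TTheory GRing.Theory Num.Theory.
Local Open Scope classical_set_scope.
Local Open Scope ring_scope.

Definition centered_gaussian_or_zero d (T : measurableType d) (R : realType)
  (P : probability T R) (Y : T -> R) : Prop :=
  P (Y @^-1` [set 0]) = 1%E \/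
  exists s : R, 0 < s /\
    forall A : set R, measurable A -> P (Y @^-1` A) = normal_prob 0 s A.

Definition nondeg_centered_gaussian d (T : measurableType d) (R : realType)
  (P : probability T R) (Y : T -> R) : Prop :=
  exists s : R, 0 < s /\
    forall A : set R, measurable A -> P (Y @^-1` A) = normal_prob 0 s A.

Definition centered_gaussian_vector3 d (T : measurableType d) (R : realType)
  (P : probability T R) (X1 X2 X3 : {RV P >-> R}) : Prop :=
  forall a1 a2 a3 : R,
    centered_gaussian_or_zero P (fun w => a1 * X1 w + a2 * X2 w + a3 * X3 w).

Definition independent3 d (T : measurableType d) (R : realType)
  (P : probability T R) (X1 X2 X3 : {RV P >-> R}) : Prop :=
  forall A1 A2 A3 : set R, measurable A1 -> measurable A2 -> measurable A3 ->
    P (X1 @^-1` A1 `&` X2 @^-1` A2 `&` X3 @^-1` A3) =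
    (P (X1 @^-1` A1) * P (X2 @^-1` A2) * P (X3 @^-1` A3))%E.

(* Main.v *)
(** Gaussian integration by parts gives [E Y^(n+1) = n E(Y^2) E Y^(n-1)] for a
    centered Gaussian [Y].  Applied to every linear combination
    [a X1 + b X2 + X3] and compared coefficientwise in [a] and [b], this yields
    [E(X1^8 X2^6 X3^4)] as a polynomial in the variances and covariances.
    After normalising the variances, the excess of this polynomial over its
    value at zero correlations is, on the set of correlations with nonnegative
    determinant, at least [4725] times the sum of the squared correlations,
    by a sum-of-squares identity.  So equality forces all covariances to vanish.

    Vanishing covariances imply independence: the moments give
    [E cos(a X1 + b X2 + c X3)] in closed form, hence products of trigonometric
    polynomials in [X1], [X2], [X3] have factorised expectations; uniformly
    bounded trigonometric polynomials converging almost surely to indicators of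
    intervals transfer this to boxes, and boxes determine the joint law.
    Conversely, independence gives [E(X^2 Y^2) = E(X^2) E(Y^2)], while the
    Gaussian formula is [E(X^2) E(Y^2) + 2 E(XY)^2]. *)
Require Import Defs.
From HB Require Import structures.
From mathcomp Require Import all_boot all_order all_algebra.
From mathcomp Require Import all_classical all_reals all_analysis.
From mathcomp Require Import measurable_realfun.
From mathcomp Require Import ring lra.
Set Implicit Arguments. Unset Strict Implicit. Unset Printing Implicit Defensive.
Import Order.TTheory GRing.Theory Num.Theory.
Import numFieldNormedType.Exports.
Local Open Scope classical_set_scope.
Local Open Scope ring_scope.

(** * The moment polynomial and its lower bound *)

(* Each coefficient counts the pairings of 8 + 6 + 4 points that produce the
   given covariances; [s_i] are variances, [c_ij] covariances. *)
Definition isserlis864 (R : fieldType) (s1 s2 s3 c12 c13 c23 : R) : R :=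
  4725 * (
    s1 ^+ 4 * s2 ^+ 3 * s3 ^+ 2
    + 24 * s1 ^+ 3 * s2 ^+ 2 * s3 ^+ 2 * c12 ^+ 2
    + 16 * s1 ^+ 3 * s2 ^+ 3 * s3 * c13 ^+ 2
    + 12 * s1 ^+ 4 * s2 ^+ 2 * s3 * c23 ^+ 2
    + 192 * s1 ^+ 3 * s2 ^+ 2 * s3 * c12 * c13 * c23
    + 48 * s1 ^+ 2 * s2 * s3 ^+ 2 * c12 ^+ 4
    + 288 * s1 ^+ 2 * s2 ^+ 2 * s3 * c12 ^+ 2 * c13 ^+ 2
    + 16 * s1 ^+ 2 * s2 ^+ 3 * c13 ^+ 4
    + 192 * s1 ^+ 3 * s2 * s3 * c12 ^+ 2 * c23 ^+ 2
    + 96 * s1 ^+ 3 * s2 ^+ 2 * c13 ^+ 2 * c23 ^+ 2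
    + 8 * s1 ^+ 4 * s2 * c23 ^+ 4
    + 768 * s1 ^+ 2 * s2 * s3 * c12 ^+ 3 * c13 * c23
    + 384 * s1 ^+ 2 * s2 ^+ 2 * c12 * c13 ^+ 3 * c23
    + 256 * s1 ^+ 3 * s2 * c12 * c13 * c23 ^+ 3
    + 64 / 5 * s1 * s3 ^+ 2 * c12 ^+ 6
    + 384 * s1 * s2 * s3 * c12 ^+ 4 * c13 ^+ 2
    + 192 * s1 * s2 ^+ 2 * c12 ^+ 2 * c13 ^+ 4
    + 192 * s1 ^+ 2 * s3 * c12 ^+ 4 * c23 ^+ 2
    + 1152 * s1 ^+ 2 * s2 * c12 ^+ 2 * c13 ^+ 2 * c23 ^+ 2
    + 64 * s1 ^+ 3 * c12 ^+ 2 * c23 ^+ 4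
    + 1536 / 5 * s1 * s3 * c12 ^+ 5 * c13 * c23
    + 1024 * s1 * s2 * c12 ^+ 3 * c13 ^+ 3 * c23
    + 512 * s1 ^+ 2 * c12 ^+ 3 * c13 * c23 ^+ 3
    + 256 / 5 * s3 * c12 ^+ 6 * c13 ^+ 2
    + 128 * s2 * c12 ^+ 4 * c13 ^+ 4
    + 768 * s1 * c12 ^+ 4 * c13 ^+ 2 * c23 ^+ 2
    + 1024 / 5 * c12 ^+ 5 * c13 ^+ 3 * c23).

(** Each pairing uses 8, 6 and 4 endpoints of the three variables, so rescaling them pulls out fixed
    powers. This reduces everything to unit variances, with [x], [y], [z] the correlations. *)
Lemma isserlis864_scale (R : realFieldType) (u v w x y z : R) :
  isserlis864 (u ^+ 2) (v ^+ 2) (w ^+ 2) (u * v * x) (u * w * y) (v * w * z) =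
  u ^+ 8 * v ^+ 6 * w ^+ 4 * isserlis864 1 1 1 x y z.
Proof. rewrite /isserlis864; by field. Qed.

(* Weights found by semidefinite programming and rounded.  The second summand
   trades the monomial [x^5 y^3 z], of odd degree 9, for [x^3 y^3 z], so that
   the squares only have to reach degree 8.  The sign of [z] is flipped so that
   [x * y * z >= 0] is the critical case. *)
Lemma isserlis864_sos (R : realFieldType) (x y z : R) :
  isserlis864 1 1 1 x y (- z) / 4725 - 1 - (x ^+ 2 + y ^+ 2 + z ^+ 2) =
    176 * (x ^+ 2 * z ^+ 2) *
      (1 - 2 * x * y * z - x ^+ 2 - y ^+ 2 - z ^+ 2)
  + 1024 / 5 * (x ^+ 2 * y ^+ 2) * (x * y * z) * (1 - x ^+ 2)
  + 256 / 5 * (x ^+ 3 * y - 5 / 16 * z - 5 / 4 * (x ^+ 2 * z)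
               + 55 / 32 * (x * y)) ^+ 2
  + 6 * (z - 6 * (x ^+ 2 * z) - 3 / 4 * (x * y)) ^+ 2
  + 24 * (x ^+ 2 * z - 13 / 24 * (x * y)) ^+ 2
  + 11 / 6 * (x * y) ^+ 2
  + 8 * (z ^+ 2 + y ^+ 2 + 3 * (x ^+ 2 * y ^+ 2) - 10 * (x * y * z)
         + 2 * x ^+ 2) ^+ 2
  + 8 * (y ^+ 2 - x ^+ 2 * y ^+ 2 - 2 * (x * y * z)) ^+ 2
  + 48 * (x ^+ 2 * y ^+ 2 - 4 / 3 * (x * y * z) + x ^+ 2 / 2) ^+ 2
  + 2 / 3 * (x * y * z) ^+ 2
  + (x ^+ 2) ^+ 2
  + 15 * (y - 32 / 15 * (x * z)) ^+ 2
  + 7 / 30 * (x * z) ^+ 2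
  + 80 * (y * z + 11 / 5 * (x ^+ 2 * y * z) - x ^+ 3 / 5
          - 6 / 5 * (x * y ^+ 2) - 3 / 5 * (x * z ^+ 2) - 2 / 5 * x) ^+ 2
  + 1904 / 5 * (x ^+ 2 * y * z - x ^+ 3 / 7 - 36 / 119 * (x * y ^+ 2)
                + 8 / 119 * (x * z ^+ 2) + 2 / 119 * x) ^+ 2
  + 64 / 35 * (x ^+ 3 - 2 * (x * y ^+ 2) + 79 / 8 * (x * z ^+ 2)
               - 279 / 128 * x) ^+ 2
  + 224 / 85 * (x * y ^+ 2 - 743 / 224 * (x * z ^+ 2) + 617 / 896 * x) ^+ 2
  + 2431 / 1120 * (x * z ^+ 2 - 173 / 748 * x) ^+ 2
  + 1871 / (64 * 748) * x ^+ 2.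
Proof. rewrite /isserlis864; by field. Qed.

(** For [x * y * z >= 0] the excess has only nonnegative terms. Otherwise the certificate is used at
    [- z]: its first summand then carries the correlation determinant, and its second is nonnegative
    by [x ^+ 2 <= 1]. *)
Lemma isserlis864_lb (R : realFieldType) (x y z : R) :
  x ^+ 2 <= 1 -> 0 <= 1 + 2 * x * y * z - x ^+ 2 - y ^+ 2 - z ^+ 2 ->
  4725 * (1 + (x ^+ 2 + y ^+ 2 + z ^+ 2)) <= isserlis864 1 1 1 x y z.
Proof.
move=> x1 det_ge0.
have x2 := sqr_ge0 x; have y2 := sqr_ge0 y; have z2 := sqr_ge0 z.
suff: 0 <= isserlis864 1 1 1 x y z / 4725 - 1 - (x ^+ 2 + y ^+ 2 + z ^+ 2).
  by move=> h; lra.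
have [xyz_ge0|xyz_lt0] := leP 0 (x * y * z); last first.
  have -> : isserlis864 1 1 1 x y z = isserlis864 1 1 1 x y (- (- z)).
    by rewrite opprK.
  rewrite -(sqrrN z) isserlis864_sos sqrrN.
  have sq (k u : R) : 0 <= k -> 0 <= k * u ^+ 2.
    by move=> k0; exact: mulr_ge0 k0 (sqr_ge0 u).
  (* Peels the weighted squares off the end of the sum, leaving the two summands that depend on the
     hypotheses. *)
  repeat (apply: addr_ge0; last first; first (apply: sqr_ge0 || apply: sq;
    by [exact: ler0n | apply: divr_ge0; [exact: ler0n|];
        do ?[exact: ler0n | apply: mulr_ge0]])).
  apply: addr_ge0.
    apply: mulr_ge0; last lra.
    by apply: mulr_ge0; [exact: ler0n|exact: mulr_ge0].
  apply: mulr_ge0; last lra.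
  apply: mulr_ge0; last lra.
  by apply: mulr_ge0; [apply: divr_ge0; exact: ler0n|exact: mulr_ge0].
(* Odd powers occur only through the common factor [x * y * z]. The coefficients 23, 15, 11 are 24,
   16, 12 lowered by the subtracted sum of squares. *)
have -> : isserlis864 1 1 1 x y z / 4725 - 1 - (x ^+ 2 + y ^+ 2 + z ^+ 2) =
    let X := x ^+ 2 in let Y := y ^+ 2 in let Z := z ^+ 2 in
    23 * X + 15 * Y + 11 * Z + 48 * X ^+ 2 + 288 * X * Y + 16 * Y ^+ 2 +
    192 * X * Z + 96 * Y * Z + 8 * Z ^+ 2 + 64 / 5 * X ^+ 3 +
    384 * X ^+ 2 * Y + 192 * X * Y ^+ 2 + 192 * X ^+ 2 * Z +
    1152 * X * Y * Z + 64 * X * Z ^+ 2 + 256 / 5 * X ^+ 3 * Y +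
    128 * X ^+ 2 * Y ^+ 2 + 768 * X ^+ 2 * Y * Z +
    x * y * z * (192 + 768 * X + 384 * Y + 256 * Z + 1536 / 5 * X ^+ 2 +
      1024 * X * Y + 512 * X * Z + 1024 / 5 * X ^+ 2 * Y).
  by rewrite /isserlis864 /=; field.
move=> /=; repeat first [exact: ler0n | exact: exprn_ge0 | assumption
  | apply: addr_ge0 | apply: divr_ge0 | apply: mulr_ge0].
Qed.

(** * Integrals against the normal density *)

Lemma Rdominated_cvg d (T : measurableType d) (R : realType)
    (mu : {measure set T -> \bar R}) (f_ : nat -> T -> R) (f g : T -> R) :
  (forall n, measurable_fun [set: T] (f_ n)) -> measurable_fun [set: T] f ->
  {ae mu, forall x, f_ n x @[n --> \oo] --> f x} ->
  mu.-integrable [set: T] (EFin \o g) -> (forall n x, `|f_ n x| <= g x) ->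
  \int[mu]_x f_ n x @[n --> \oo] --> \int[mu]_x f x.
Proof.
move=> mf_ mf f_f ig f_g.
have [|||||intf _] := @dominated_convergence _ T R mu setT measurableT
    (fun n x => (f_ n x)%:E) (EFin \o f) (EFin \o g).
- by move=> n; exact/measurable_EFinP.
- exact/measurable_EFinP.
- by apply: filterS f_f => x fx _; apply: cvg_EFin => //; exact: nearW.
- by [].
- by apply: aeW => x n _ /=; rewrite lee_fin.
- move=> h; apply: fine_cvg; rewrite fineK//; exact: integrable_fin_num.
Qed.

Section normal_integrals.
Context {R : realType}.
Variable s : R.
Hypothesis s0 : s != 0.
Local Notation mu := (@lebesgue_measure R).
Local Notation pdf := (normal_pdf 0 s).

(** The Radon-Nikodym derivative of the normal law and [normal_pdf] have the same integral over
    every measurable set, so they agree almost everywhere. *)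
Lemma ge0_integral_normal_prob (f : R -> \bar R) :
  measurable_fun [set: R] f -> (forall x, 0 <= f x)%E ->
  (\int[normal_prob 0 s]_x f x = \int[mu]_x (f x * (pdf x)%:E))%E.
Proof.
move=> mf f0.
have dom := @normal_prob_dominates R 0 s.
rewrite -(Radon_Nikodym_SigmaFinite.change_of_variables dom)//.
apply: ae_eq_integral => //.
- apply: emeasurable_funM => //.
  exact: measurable_int (Radon_Nikodym_SigmaFinite.f_integrable dom).
- apply: emeasurable_funM => //; apply/measurable_EFinP.
  exact: measurable_normal_pdf.
- apply: ae_eqe_mul2l; apply: integral_ae_eq => //.
  + exact: Radon_Nikodym_SigmaFinite.f_integrable.
  + by apply/measurable_EFinP; exact: measurable_normal_pdf.
  + by move=> E _ mE; rewrite -(Radon_Nikodym_SigmaFinite.f_integral dom).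
Qed.

(** Completing the square: an exponential tilt only shifts the mean. Exponential moments, and hence
    all domination bounds below, follow from it. *)
Lemma expR_normal_pdf (t x : R) :
  expR (t * x) * pdf x =
  expR (s ^+ 2 * t ^+ 2 / 2) * normal_pdf (s ^+ 2 * t) s x.
Proof.
rewrite /normal_pdf (negbTE s0) /normal_fun mulrCA [RHS]mulrCA.
by rewrite -!expRD; congr (_ * expR _); field.
Qed.

Lemma integrable_expR_normal_pdf (t : R) :
  mu.-integrable setT (fun x => (expR (t * x) * pdf x)%:E).
Proof.
under eq_fun do rewrite expR_normal_pdf EFinM.
by apply: integrableZl => //; exact: integrable_normal_pdf.
Qed.

Lemma normrXn_le_expR n (x : R) :
  `|x| ^+ n <= n`!%:R * (expR x + expR (- x)).
Proof.
have : `|x| ^+ n / n`!%:R <= expR `|x|.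
  case: n => [|n].
    by rewrite expr0 fact0 divr1 (le_trans _ (expR_ge1Dx _))// lerDl.
  by have := expR_ge1Dxn n (normr_ge0 x); apply: le_trans; rewrite lerDr.
rewrite ler_pdivrMr ?ltr0n ?fact_gt0// mulrC => /le_trans; apply.
rewrite ler_wpM2l//; case: (ger0P x) => _.
  by rewrite lerDl expR_ge0.
by rewrite lerDr expR_ge0.
Qed.

Lemma normr_Xn_normal_pdf_le n (x : R) :
  `|x ^+ n * pdf x| <=
  n`!%:R * (expR (1 * x) * pdf x + expR (- 1 * x) * pdf x).
Proof.
rewrite normrM (ger0_norm (normal_pdf_ge0 _ _ _)) normrX -mulrDl mulrA.
by rewrite ler_wpM2r ?normal_pdf_ge0// mulN1r mul1r normrXn_le_expR.
Qed.

Lemma integrable_Xn_normal_pdf n :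
  mu.-integrable setT (fun x => (x ^+ n * pdf x)%:E).
Proof.
have mX : measurable_fun setT (fun x : R => x ^+ n) by exact: measurable_funX.
apply: (@le_integrable _ _ _ mu _ measurableT _
  (fun x => (n`!%:R)%:E * ((expR (1 * x) * pdf x)%:E +
     (expR (- 1 * x) * pdf x)%:E))%E) => //.
- by apply/measurable_EFinP/measurable_funM => //; exact: measurable_normal_pdf.
- move=> x _; rewrite -EFinD -EFinM !abse_EFin lee_fin.
  exact: le_trans (normr_Xn_normal_pdf_le n x) (ler_norm _).
- apply: integrableZl => //.
  by apply: integrableD => //; exact: integrable_expR_normal_pdf.
Qed.

(** These are the boundary terms of the integration by parts, with [e] the sign of the endpoint. The
    next power times the density is bounded by a constant [C], so the term is at most [C / k]. *)
Lemma cvg_Xn_normal_pdf n (e : R) : (e == 1) || (e == -1) ->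
  (e * k%:R) ^+ n * pdf (e * k%:R) @[k --> \oo] --> (0 : R).
Proof.
move=> e1; have ne : `|e| = 1.
  by case/orP: e1 => /eqP ->; rewrite ?normrN normr1.
pose C : R := (n.+1)`!%:R *
  (expR (s ^+ 2 * 1 ^+ 2 / 2) * normal_peak s +
   expR (s ^+ 2 * (- 1) ^+ 2 / 2) * normal_peak s).
have bnd x : `|x ^+ n.+1 * pdf x| <= C.
  apply: le_trans (normr_Xn_normal_pdf_le _ _) _.
  by rewrite ler_wpM2l// !expR_normal_pdf lerD// ler_wpM2l ?expR_ge0//
    normal_pdf_ub.
apply/cvgr0Pnorm_le => eps eps0.
have [N _ hN] : \forall k \near \oo, C / eps + 1 <= k%:R.
  exact: nbhs_infty_ger.
exists N => // k /= /hN Ck.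
have C0 : 0 <= C by exact: le_trans (bnd 0).
have k0 : 0 < k%:R :> R by apply: lt_le_trans Ck; rewrite ltr_wpDl// divr_ge0// ltW.
have := bnd (e * k%:R); rewrite exprS -mulrA normrM normrM ne mul1r.
rewrite (ger0_norm (ltW k0)) mulrC -ler_pdivlMr// => /le_trans; apply.
rewrite ler_pdivrMr// mulrC -ler_pdivrMr//; apply: le_trans Ck.
by rewrite lerDl.
Qed.

Lemma is_derive_normal_pdf (x : R) :
  is_derive x 1 pdf (- (x / s ^+ 2) * pdf x).
Proof.
have -> : pdf = (fun x => normal_peak s * expR (- x ^+ 2 / (s ^+ 2 *+ 2))) :> (R -> R).
  apply/funext => y; rewrite /normal_pdf (negbTE s0) /normal_fun.
  by rewrite subr0.
apply: is_derive_eq; rewrite /GRing.scale /=; field; exact: s0.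
Qed.

(** Integration by parts: the difference of the two integrands is the derivative of [F], which
    vanishes at both infinities. For [n = 0] the truncated exponent [n.-1] is harmless because of
    the factor [n%:R]. *)
Lemma integral_Xn_normal_pdf n :
  \int[mu]_x (x ^+ n.+1 * pdf x) =
  n%:R * s ^+ 2 * \int[mu]_x (x ^+ n.-1 * pdf x).
Proof.
pose F (x : R) : R := - s ^+ 2 * (x ^+ n * pdf x).
pose f (x : R) := x ^+ n.+1 * pdf x - n%:R * s ^+ 2 * (x ^+ n.-1 * pdf x).
have dF (x : R) : is_derive x 1 F (f x).
  have hX : is_derive x 1 ((@id R) ^+ n) (n%:R * x ^+ n.-1).
    by apply: is_derive_eq; rewrite /GRing.scale /= mulr1.
  have := is_deriveZ (- s ^+ 2) (is_deriveM hX (is_derive_normal_pdf x)).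
  move=> h; have -> : F = (- s ^+ 2) \*: (((@id R) ^+ n) * pdf).
    by apply/funext => y; rewrite /F /= exprfctE.
  apply: is_derive_eq h _; rewrite /f /GRing.scale /= exprfctE (exprS x n).
  by field; exact: s0.
have cf : continuous f.
  move=> x; apply: cvgB; [apply: cvgM|apply: cvgMl_tmp; apply: cvgM];
    try exact: exprn_continuous; exact: continuous_normal_pdf.
have int1 := integrable_Xn_normal_pdf n.+1.
have int2 : mu.-integrable setT
    (fun x => (n%:R * s ^+ 2 * (x ^+ n.-1 * pdf x))%:E).
  by under eq_fun do rewrite EFinM; apply: integrableZl => //;
    exact: integrable_Xn_normal_pdf.
have int_f : mu.-integrable setT (EFin \o f).
  exact: (integrableB measurableT int1 int2).
suff : \int[mu]_x f x = 0.
  rewrite /f RintegralB// RintegralZl//; last exact: integrable_Xn_normal_pdf.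
  by move/eqP; rewrite subr_eq0 => /eqP.
(* The bounds use [k.+1] so that the interval is nondegenerate for every [k]. *)
have intk k : \int[mu]_x (f \_ `[- k.+1%:R, k.+1%:R]) x = F (k.+1%:R) - F (- k.+1%:R).
  rewrite -Rintegral_mkcond /Rintegral (@continuous_FTC2 _ f F)//.
  - by rewrite gtrN.
  - exact: continuous_subspaceT.
  - have cF x : {for x, continuous F}.
      have [dFx _] := dF x.
      exact: differentiable_continuous ((derivable1_diffP _ _).1 dFx).
    split.
    + by move=> x _; have := dF x => -[].
    + exact/cvg_at_right_filter/cF.
    + exact/cvg_at_left_filter/cF.
  - by move=> x _; rewrite derive1E; apply: derive_val.
have lim1 : \int[mu]_x (f \_ `[- k.+1%:R, k.+1%:R]) x @[k --> \oo] -->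
    \int[mu]_x f x.
  apply: (@Rdominated_cvg _ _ R mu (fun k => f \_ `[- k.+1%:R, k.+1%:R]) f
    (fun x => `|f x|)).
  - move=> k; apply/(measurable_restrictT _ _).1 => //.
    apply: measurable_funTS. exact: continuous_measurable_fun cf.
  - exact: continuous_measurable_fun cf.
  - apply: aeW => x; apply: cvg_near_cst.
    have [N _ hN] : \forall j \near \oo, `|x| <= j%:R.
      exact: nbhs_infty_ger.
    exists N => // k /= /hN xk.
    rewrite patchE mem_set//= in_itv /= -ler_norml.
    by rewrite (le_trans xk)// ler_nat.
  - exact: integrable_norm.
  - by move=> k x; rewrite patchE; case: ifP => // _; rewrite normr0.
have lim2 : F k.+1%:R - F (- k.+1%:R) @[k --> \oo] --> (0 : R).
  rewrite -[X in _ --> X](subr0 0) -{1}(mulr0 (- s ^+ 2)) -{2}(mulr0 (- s ^+ 2)).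
  have Xpdf e : (e == 1) || (e == -1) ->
      (e * k.+1%:R) ^+ n * pdf (e * k.+1%:R) @[k --> \oo] --> (0 : R).
    move=> /(cvg_Xn_normal_pdf n).
    by rewrite -(cvg_shiftS (fun k => (e * k%:R) ^+ n * pdf (e * k%:R))).
  apply: cvgB; apply: cvgMl_tmp.
    have := Xpdf 1; rewrite eqxx => /(_ isT); apply: cvg_trans.
    by apply: near_eq_cvg; apply: nearW => k; rewrite mul1r.
  have := Xpdf (-1); rewrite eqxx orbT => /(_ isT); apply: cvg_trans.
  by apply: near_eq_cvg; apply: nearW => k; rewrite mulN1r.
apply: cvg_unique lim1 _ => //.
apply: cvg_trans lim2.
by apply: near_eq_cvg; apply: nearW => k; rewrite intk.
Qed.

End normal_integrals.

(** * Moments and characteristic function of a Gaussian variable *)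

(** A bound uniform in [n], integrable under any Gaussian law; it dominates the partial sums of the
    sine and cosine series. *)
Lemma normr_series_expR_le (R : realType) (c : R^nat) (x : R) n :
  (forall j, `|c j| <= exp_coeff `|x| j) ->
  `|series c n| <= expR x + expR (- x).
Proof.
move=> cle; apply: (@le_trans _ _ (expR `|x|)).
  apply: le_trans (ler_norm_sum _ _ _) _.
  apply: (@le_trans _ _ (series (exp_coeff `|x|) n)); first exact: ler_sum.
  apply: nondecreasing_cvgn_le; last exact: is_cvg_series_exp_coeff.
  by apply: nondecreasing_series => j _ _; exact: exp_coeff_ge0.
by case: (ger0P x) => _; rewrite ?lerDl ?lerDr expR_ge0.
Qed.

Lemma normr_cos_coeff_le (R : realType) (x : R) j :
  `|cos_coeff x j| <= exp_coeff `|x| j.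
Proof.
rewrite /cos_coeff /exp_coeff /= !normrM normfV !normr_nat !normrX normrN1.
rewrite expr1n mulr1 ler_pM2r ?invr_gt0 ?ltr0n ?fact_gt0//.
by case: (odd j) => /=; rewrite ?mul0r ?mul1r.
Qed.

Lemma normr_sin_coeff_le (R : realType) (x : R) j :
  `|sin_coeff x j| <= exp_coeff `|x| j.
Proof.
rewrite /sin_coeff /exp_coeff /= !normrM normfV !normr_nat !normrX normrN1.
rewrite expr1n mulr1 ler_pM2r ?invr_gt0 ?ltr0n ?fact_gt0//.
by case: (odd j) => /=; rewrite ?mul0r ?mul1r.
Qed.

Section gaussian_variable.
Context d (T : measurableType d) (R : realType) (P : probability T R).
Variable Y : T -> R.
Hypothesis mY : measurable_fun [set: T] Y.

Section nondegenerate.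
Variable s : R.
Hypothesis s0 : s != 0.
Hypothesis lawY : forall A : set R, measurable A ->
  P (Y @^-1` A) = normal_prob 0 s A.
Local Notation mu := (@lebesgue_measure R).

Lemma ge0_integral_gaussian (f : R -> \bar R) :
  measurable_fun [set: R] f -> (forall x, 0 <= f x)%E ->
  (\int[P]_w f (Y w) = \int[mu]_x (f x * (normal_pdf 0 s x)%:E))%E.
Proof.
move=> mf f0; rewrite -ge0_integral_normal_prob//.
have mY' : @measurable_fun _ _ T (measurableTypeR R) setT Y by exact: mY.
pose Z : {mfun T >-> measurableTypeR R} :=
  HB.pack (Y : T -> measurableTypeR R) (isMeasurableFun.Build _ _ _ _ _ mY').
have -> : (\int[P]_w f (Y w) = \int[pushforward P Z]_x f x)%E.
  by rewrite (ge0_integral_pushforward (phi := Z))//; exact: measurable_funTS.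
by apply: eq_measure_integral => A mA _; exact: lawY.
Qed.

Lemma integral_gaussian (g : R -> R) : measurable_fun [set: R] g ->
  (\int[P]_w (g (Y w))%:E = \int[mu]_x (g x * normal_pdf 0 s x)%:E)%E.
Proof.
move=> mg; rewrite integralE [RHS]integralE.
have mE : measurable_fun [set: R] (EFin \o g) by exact/measurable_EFinP.
have -> : (fun w => (g (Y w))%:E) = (EFin \o g) \o Y by [].
rewrite funepos_comp funeneg_comp.
rewrite (ge0_integral_gaussian (f := (EFin \o g)^\+%E))//; last first.
  exact: measurable_funepos.
rewrite (ge0_integral_gaussian (f := (EFin \o g)^\-%E))//; last first.
  exact: measurable_funeneg.
congr (_ - _)%E; apply: eq_integral => x _.
- by rewrite [LHS]muleC !funeposE maxe_pMr ?lee_fin ?normal_pdf_ge0// mule0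
    EFinM muleC.
- by rewrite [LHS]muleC !funenegE maxe_pMr ?lee_fin ?normal_pdf_ge0// mule0
    EFinM muleN muleC.
Qed.

Lemma integrable_gaussian (g : R -> R) : measurable_fun [set: R] g ->
  mu.-integrable setT (fun x => (g x * normal_pdf 0 s x)%:E) ->
  P.-integrable setT (fun w => (g (Y w))%:E).
Proof.
move=> mg /integrableP[_ ig]; apply/integrableP; split.
  by apply/measurable_EFinP; exact: measurableT_comp.
rewrite (ge0_integral_gaussian (f := fun x => `|(g x)%:E|%E))//; last first.
  by apply: measurableT_comp => //; exact/measurable_EFinP.
apply: le_lt_trans ig; rewrite le_eqVlt; apply/orP; left; apply/eqP.
apply: eq_integral => x _.
by rewrite EFinM abseM (gee0_abs (x := (normal_pdf 0 s x)%:E)) ?lee_fin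
  ?normal_pdf_ge0.
Qed.
End nondegenerate.
Hypothesis gY : centered_gaussian_or_zero P Y.

Lemma ae_eq0_of_preimage : P (Y @^-1` [set 0]) = 1%E -> {ae P, forall w, Y w = 0}.
Proof.
move=> PY0; have mY0 : measurable (Y @^-1` [set 0]).
  by rewrite -[X in measurable X]setTI; apply: mY.
exists (~` (Y @^-1` [set 0])); split => //; first exact: measurableC.
by rewrite probability_setC// PY0 subee.
Qed.

(** In the degenerate case the integrand is almost surely the constant [g 0]; otherwise
    integrability is read off the density. *)
Lemma gaussian_integrable (g : R -> R) : measurable_fun [set: R] g ->
  (forall s, s != 0 -> (@lebesgue_measure R).-integrable setT
    (fun x => (g x * normal_pdf 0 s x)%:E)) ->
  P.-integrable setT (fun w => (g (Y w))%:E).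
Proof.
move=> mg ig; case: gY => [/ae_eq0_of_preimage Y0|[s [s_gt0 lawY]]].
  apply/integrableP; split.
    by apply/measurable_EFinP; exact: measurableT_comp.
  rewrite (ae_eq_integral (cst `|(g 0)%:E|%E))//.
  - by rewrite integral_cst//= probability_setT mule1 ltry.
  - by apply: measurableT_comp => //; apply/measurable_EFinP; exact: measurableT_comp.
  - by apply: filterS Y0 => w -> _.
by apply: (integrable_gaussian lawY) => //; apply: ig; rewrite lt0r_neq0.
Qed.

Lemma gaussian_integrableX n : P.-integrable setT (fun w => (Y w ^+ n)%:E).
Proof.
apply: (gaussian_integrable (g := fun x => x ^+ n)).
  exact: measurable_funX.
by move=> s s0; exact: integrable_Xn_normal_pdf.
Qed.

Lemma gaussian_integrable_expR (t : R) :
  P.-integrable setT (fun w => (expR (t * Y w))%:E).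
Proof.
apply: (gaussian_integrable (g := fun x => expR (t * x))).
  by apply: measurableT_comp => //; exact: measurable_funM.
by move=> s s0; exact: integrable_expR_normal_pdf.
Qed.

(** Written with the second moment in place of the parameter [s], the recursion also covers the zero
    variable, for which both sides vanish. *)
Lemma gaussian_moment_rec n :
  \int[P]_w (Y w ^+ n.+1) =
  n%:R * (\int[P]_w (Y w ^+ 2)) * (\int[P]_w (Y w ^+ n.-1)).
Proof.
have mYX k : measurable_fun setT (fun w => Y w ^+ k) by exact: measurable_funX.
case: gY => [/ae_eq0_of_preimage Y0|[s [s_gt0 lawY]]].
  have EX k : \int[P]_w (Y w ^+ k.+1) = 0.
    rewrite /Rintegral (ae_eq_integral (cst 0%E)) ?integral_cst//= ?mul0e//.
    - exact/measurable_EFinP.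
    - by apply: filterS Y0 => w -> _; rewrite expr0n.
  by rewrite !EX mulr0 mul0r.
have EY k : \int[P]_w (Y w ^+ k) =
    \int[lebesgue_measure]_x (x ^+ k * normal_pdf 0 s x).
  rewrite /Rintegral; congr fine.
  by rewrite (integral_gaussian lawY (g := fun x => x ^+ k))//;
    exact: measurable_funX.
have s0 := lt0r_neq0 s_gt0.
(* The total mass 1, fed into the recursion at [n = 1], identifies [s ^+ 2] with the second
   moment. *)
have I0 : \int[lebesgue_measure]_x (x ^+ 0 * normal_pdf 0 s x) = 1.
  under eq_Rintegral do rewrite mul1r.
  by rewrite /Rintegral integral_normal_pdf.
by rewrite !EY !integral_Xn_normal_pdf//= I0 mul1r mulr1.
Qed.

Lemma gaussian_moment_odd k : \int[P]_w (Y w ^+ k.*2.+1) = 0.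
Proof.
elim: k => [|k IH]; first by rewrite gaussian_moment_rec !mul0r.
by rewrite doubleS gaussian_moment_rec /= IH mulr0.
Qed.

(** Dividing by the factorial turns even moments into coefficients of an exponential series; this is
    the form used for the cosine series and for comparing polynomial coefficients. *)
Lemma gaussian_moment_even k :
  \int[P]_w (Y w ^+ k.*2) / k.*2`!%:R =
  (\int[P]_w (Y w ^+ 2) / 2) ^+ k / k`!%:R.
Proof.
elim: k => [|k IH].
  under eq_Rintegral do rewrite expr0.
  by rewrite Rintegral_cst//= probability_setT mulr1 !fact0 expr0.
rewrite doubleS gaussian_moment_rec /= exprS.
transitivity ((\int[P]_w Y w ^+ 2 / 2) / k.+1%:R *
   (\int[P]_w (Y w ^+ k.*2) / k.*2`!%:R)).
  have -> : (k.*2.+2)`!%:R = 2 * k.+1%:R * k.*2.+1%:R * k.*2`!%:R :> R.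
    by rewrite -[2 * k.+1%:R](natrM R 2 k.+1) mul2n !factS !natrM mulrA.
  have f0 : k.*2`!%:R != 0 :> R by rewrite pnatr_eq0 -lt0n fact_gt0.
  have k0 : k.+1%:R != 0 :> R by rewrite pnatr_eq0.
  have k20 : k.*2.+1%:R != 0 :> R by rewrite pnatr_eq0.
  by field; rewrite f0 !nat1r k0 k20.
rewrite IH factS natrM.
have f0 : k`!%:R != 0 :> R by rewrite pnatr_eq0 -lt0n fact_gt0.
have k0 : k.+1%:R != 0 :> R by rewrite pnatr_eq0.
by field; rewrite f0 nat1r k0.
Qed.

Lemma integrable_series_gaussian (c : R -> R^nat) (a : R^nat) n :
  (forall x j, c x j = a j * x ^+ j) ->
  P.-integrable setT (fun w => (series (c (Y w)) n)%:E) /\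
  \int[P]_w series (c (Y w)) n = \sum_(0 <= j < n) a j * \int[P]_w (Y w ^+ j).
Proof.
move=> cE; elim: n => [|n [IHi IHe]].
  rewrite /series /=; under eq_fun do rewrite big_geq//.
  under eq_Rintegral do rewrite big_geq//.
  split; first exact: integrable0.
  by rewrite big_geq// Rintegral_cst//= mul0r.
have eqS w : series (c (Y w)) n.+1 = series (c (Y w)) n + a n * Y w ^+ n.
  by rewrite /series /= big_nat_recr//= cE.
have int_n : P.-integrable setT (fun w => (a n * Y w ^+ n)%:E).
  by under eq_fun do rewrite EFinM; apply: integrableZl => //;
    exact: gaussian_integrableX.
split.
  by under eq_fun do rewrite eqS EFinD; exact: integrableD.
under eq_Rintegral do rewrite eqS.
rewrite RintegralD// IHe RintegralZl//; last exact: gaussian_integrableX.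
by rewrite big_nat_recr.
Qed.

(** Termwise integration of a power series dominated by the exponential one: the partial sums are
    bounded by [expR Y + expR (- Y)], which is integrable. *)
Lemma cvg_integral_series_gaussian (c : R -> R^nat) (a : R^nat) (f : R -> R) :
  (forall x j, c x j = a j * x ^+ j) ->
  (forall x j, `|c x j| <= exp_coeff `|x| j) ->
  measurable_fun [set: R] f ->
  (forall x, series (c x) @ \oo --> f x) ->
  \sum_(0 <= j < n) a j * \int[P]_w (Y w ^+ j) @[n --> \oo] --> \int[P]_w f (Y w).
Proof.
move=> cE cle mf cf.
have : \int[P]_w series (c (Y w)) n @[n --> \oo] --> \int[P]_w f (Y w).
  apply: (Rdominated_cvg
    (g := fun w => expR (1 * Y w) + expR (- 1 * Y w))).
  - move=> n; apply/measurable_EFinP.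
    exact: (measurable_int P (integrable_series_gaussian n cE).1).
  - exact: measurableT_comp.
  - by apply: aeW => w; exact: cf.
  - exact: (integrableD measurableT (gaussian_integrable_expR 1)
      (gaussian_integrable_expR (- 1))).
  - by move=> n w; rewrite mul1r mulN1r; exact: normr_series_expR_le.
apply: cvg_trans; apply: near_eq_cvg; apply: nearW => n.
by rewrite (integrable_series_gaussian n cE).2.
Qed.

Lemma gaussian_sin : \int[P]_w sin (Y w) = 0.
Proof.
have := @cvg_integral_series_gaussian (@sin_coeff R)
  (fun n => (odd n)%:R * (-1) ^+ n.-1./2 / n`!%:R) (@sin R).
move=> /(_ _ _ _ _)/cvg_unique h; apply: h => //.
- by move=> x j; rewrite /sin_coeff /= mulrAC.
- by move=> x j; exact: normr_sin_coeff_le.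
- exact: continuous_measurable_fun (@continuous_sin R).
- move=> x; rewrite unlock; exact: is_cvg_series_sin_coeff.
apply: cvg_near_cst; apply: nearW => n; apply: big1 => j _.
have [jodd|] := boolP (odd j); last by rewrite !mul0r.
by rewrite -(odd_double_half j) jodd gaussian_moment_odd mulr0.
Qed.

Lemma gaussian_cos :
  \int[P]_w cos (Y w) = expR (- (\int[P]_w (Y w ^+ 2) / 2)).
Proof.
pose a (n : nat) : R := (~~ odd n)%:R * (-1) ^ n./2 / n`!%:R.
have := @cvg_integral_series_gaussian (@cos_coeff R) a (@cos R).
move=> /(_ _ _ _ _) lim.
have {lim} : \sum_(0 <= j < n) a j * \int[P]_w (Y w ^+ j) @[n --> \oo] -->
    \int[P]_w cos (Y w).
  apply: lim => //.
  - by move=> x j; rewrite /cos_coeff /a /= mulrAC.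
  - by move=> x j; exact: normr_cos_coeff_le.
  - exact: continuous_measurable_fun (@continuous_cos R).
  - move=> x; rewrite unlock; exact: is_cvg_series_cos_coeff.
pose u n : R := a n * \int[P]_w (Y w ^+ n).
move=> limu; have cu : series u @ \oo --> \int[P]_w cos (Y w) by exact: limu.
(* The odd terms of the cosine series vanish. Grouping terms in pairs leaves the even moments, which
   form the exponential series at minus half the variance. *)
have := cvg_series_cvg_series_group (cvgP _ cu) (isT : (0 < 2)%N).
rewrite (cvg_lim _ cu)// => /cvg_unique h; apply: h => //.
rewrite (_ : (fun n => _) = exp_coeff (- (\int[P]_w (Y w ^+ 2) / 2))).
  exact: is_cvg_series_exp_coeff.
apply/funext => n; rewrite !muln2 big_nat_recl// big_nat_recl// big_geq// addr0.
rewrite /u /a /exp_coeff /= !odd_double /= mul0r !mul0r addr0 mul1r.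
rewrite (half_bit_double n false) -mulrA [_^-1 * _]mulrC.
by rewrite gaussian_moment_even exprNn mulrA.
Qed.

End gaussian_variable.

(** * Mixed moments of a Gaussian vector *)

(** The difference of the two polynomials vanishes at as many distinct naturals as its size, so it
    is zero. *)
Lemma coef_eq_of_horner (R : numDomainType) (p : {poly R}) (c : R^nat) n :
  (forall x, \sum_(i < n) c i * x ^+ i = p.[x]) ->
  forall i, (i < n)%N -> c i = p`_i.
Proof.
move=> cp i ltin; have pE : p = \poly_(i < n) c i.
  apply/eqP; rewrite -subr_eq0; apply/eqP.
  pose q := p - \poly_(i < n) c i.
  apply: (@roots_geq_poly_eq0 _ q [seq k%:R | k <- iota 0 (size q)]).
  - apply/allP => _ /mapP[k _ ->]; rewrite rootE hornerD hornerN horner_poly.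
    by rewrite cp subrr.
  - by rewrite map_inj_uniq ?iota_uniq// => j k /eqP; rewrite eqr_nat => /eqP.
  - by rewrite size_map size_iota.
by rewrite pE coef_poly ltin.
Qed.

(** Write the trinomial as [c + X (b + a X)] and expand twice: [j] counts the factors [X (b + a X)],
    and [k - j] of them contribute [a X]. The guard [j <= k] excludes truncated subtraction. *)
Lemma coef_trinomial_expn (R : comNzRingType) (a b c : R) n k :
  ((c%:P + b *: 'X + a *: 'X^2) ^+ n)`_k =
  \sum_(0 <= j < n.+1 | (j <= k)%N) ('C(n, j) * 'C(j, k - j))%:R *
    (c ^+ (n - j) * b ^+ (j - (k - j)) * a ^+ (k - j)).
Proof.
have -> : c%:P + b *: 'X + a *: 'X^2 = c%:P + 'X * (b%:P + a *: 'X).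
  by rewrite -addrA mulrDr -!mul_polyC; ring.
rewrite exprDn coef_sum big_mkord [RHS]big_mkcond /=; apply: eq_bigr => j _.
rewrite coefMn -polyC_exp coefCM exprMn coefXnM ltnNge.
case: leqP => jk; rewrite /= ?mulr0 ?mul0rn// mulr_natl mulnC mulrnA.
congr (_ *+ _); rewrite -mulrA -mulrnAr; congr (_ * _).
rewrite exprDn coef_sum.
have coefE (i : 'I_j.+1) : (b%:P ^+ (j - i) * (a *: 'X) ^+ i *+ 'C(j, i))`_(k - j) =
    if (k - j == i)%N then b ^+ (j - i) * a ^+ i *+ 'C(j, i) else 0.
  rewrite coefMn -polyC_exp coefCM exprZn coefZ coefXn.
  by case: eqP => _; rewrite ?mulr1// !mulr0 mul0rn.
rewrite (eq_bigr _ (fun i _ => coefE i)) -big_mkcond /=.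
have [kj|kj] := leqP (k - j) j; last first.
  rewrite bin_small// mulr0n big1// => i /eqP kji.
  by move: kj (ltn_ord i); rewrite kji ltnS => /leq_trans h /h; rewrite ltnn.
by rewrite (big_pred1 (Ordinal (kj : (k - j < j.+1)%N)))// => i; rewrite eq_sym.
Qed.

Lemma coef8_trinomial_exp9 (R : comNzRingType) (a b c : R) :
  ((c%:P + b *: 'X + a *: 'X^2) ^+ 9)`_8 =
  9 * (14 * a ^+ 4 * c ^+ 5 + 140 * a ^+ 3 * b ^+ 2 * c ^+ 4 +
       140 * a ^+ 2 * b ^+ 4 * c ^+ 3 + 28 * a * b ^+ 6 * c ^+ 2 + b ^+ 8 * c).
Proof.
rewrite coef_trinomial_expn big_mkcond !big_nat_recl//= big_geq//= !subSS !subn0.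
(* Only [j] from 4 to 8 contributes: a smaller [j] makes ['C(j, 8 - j)] zero, and [j = 9] fails the
   guard. *)
have binE : (('C(9, 4) = 126%N) * ('C(9, 5) = 126%N) * ('C(9, 6) = 84%N) *
  ('C(9, 7) = 36%N) * ('C(9, 8) = 9%N) * ('C(0, 8) = 0%N) * ('C(1, 7) = 0%N) *
  ('C(2, 6) = 0%N) * ('C(3, 5) = 0%N) * ('C(5, 3) = 10%N) *
  ('C(6, 2) = 15%N))%type by [].
by rewrite !binE !muln0 !(bin0, bin1, binn); ring.
Qed.

Section mixed_moments.
Context d (T : measurableType d) (R : realType) (P : probability T R).

Lemma Rintegral_sum (f : nat -> T -> R) n :
  (forall i, (i < n)%N -> P.-integrable setT (EFin \o f i)) ->
  \int[P]_w (\sum_(i < n) f i w) = \sum_(i < n) \int[P]_w f i w.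
Proof.
elim: n => [|n IH] fi.
  under eq_Rintegral do rewrite big_ord0.
  by rewrite big_ord0 Rintegral_cst//= mul0r.
under eq_Rintegral do rewrite big_ord_recr /=.
rewrite big_ord_recr /= RintegralD//; last exact: fi.
  by rewrite IH// => i ltin; apply: fi; exact: ltnW.
rewrite (_ : _ \o _ = fun w => (\sum_(i < n) (f i w)%:E)%E).
  by apply: integrable_sum => //= i _; apply: fi; exact: ltnW (ltn_ord i).
by apply/funext => w /=; rewrite sumEFin.
Qed.

(** A class closed under products and powers, so that every monomial in the coordinates is
    integrable without any joint density. *)
Definition all_moments (f : T -> R) :=
  measurable_fun [set: T] f /\
  forall n, P.-integrable [set: T] (fun w => (f w ^+ n)%:E).

Lemma all_moments_integrable f : all_moments f -> P.-integrable setT (EFin \o f).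
Proof. by move=> [_ /(_ 1%N)]. Qed.

Lemma all_momentsX f n : all_moments f -> all_moments (fun w => f w ^+ n).
Proof.
move=> [mf fi]; split; first exact: measurable_funX.
by move=> k; under eq_fun do rewrite -exprM; exact: fi.
Qed.

Lemma all_momentsM f g : all_moments f -> all_moments g ->
  all_moments (fun w => f w * g w).
Proof.
move=> [mf fi] [mg gi]; split; first exact: measurable_funM.
(* The power [n] of the product is dominated by [f ^ (2 n) + g ^ (2 n)]. *)
move=> n; apply: (le_integrable measurableT _ _
  (integrableD measurableT (fi n.*2) (gi n.*2))).
  by apply/measurable_EFinP; apply: measurable_funX; exact: measurable_funM.
move=> w _; rewrite -EFinD !abse_EFin lee_fin exprMn -!muln2 !exprM.
rewrite [leRHS]ger0_norm ?addr_ge0 ?sqr_ge0// ler_norml.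
set x := f w ^+ n; set y := g w ^+ n.
have := sqr_ge0 (x + y); have := sqr_ge0 (x - y).
have := sqr_ge0 x; have := sqr_ge0 y.
by move=> *; apply/andP; split; nra.
Qed.

Lemma all_moments_cst (a : R) : all_moments (fun=> a).
Proof.
by split=> // n; exact: (finite_measure_integrable_cst _ _ measurableT).
Qed.

Lemma gaussian_all_moments Y : measurable_fun [set: T] Y ->
  centered_gaussian_or_zero P Y -> all_moments Y.
Proof. by move=> mY gY; split=> // n; exact: gaussian_integrableX. Qed.

End mixed_moments.

(* Product of polynomials given by coefficient lists, in a form that [/=]
   evaluates on explicit lists. *)
Fixpoint seq_mul (R : pzSemiRingType) (s t : seq R) : seq R :=
  if s is a :: s' then
    (fix add (u v : seq R) := match u, v with
       | x :: u', y :: v' => x + y :: add u' v'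
       | [::], _ => v
       | _, [::] => u
       end) [seq a * y | y <- t] (0 :: seq_mul s' t)
  else [::].

Lemma Poly_seq_mul (R : comNzRingType) (s t : seq R) :
  Poly (seq_mul s t) = Poly s * Poly t.
Proof.
elim: s => [|a s IH] /=; first by rewrite mul0r.
set add := (fix add (u v : seq R) := _).
have addE u v : Poly (add u v) = Poly u + Poly v.
  elim: u v => [|x u IHu] [|y v] /=; rewrite ?add0r ?addr0// IHu !cons_poly_def.
  by rewrite polyCD; ring.
rewrite addE /= cons_poly_def addr0 IH cons_poly_def mulrDl addrC; congr (_ + _).
  by rewrite mulrAC.
elim: t {IH} => [|y t IHt] /=; first by rewrite mulr0.
by rewrite IHt !cons_poly_def polyCM; ring.
Qed.

(** Moves a coefficient of a product of powers onto explicit lists, where it is obtained by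
    computation. *)
Lemma coef_Poly_expM (R : comNzRingType) (s t : seq R) m n k :
  (Poly s ^+ m * Poly t ^+ n)`_k =
  (seq_mul (iter m (seq_mul s) [:: 1]) (iter n (seq_mul t) [:: 1]))`_k.
Proof.
have PolyX u j : Poly (iter j (seq_mul u) [:: 1]) = Poly u ^+ j :> {poly R}.
  elim: j => [|j IH]; first by rewrite /= cons_poly_def mul0r add0r expr0.
  by rewrite iterS Poly_seq_mul IH exprS.
by rewrite -!PolyX -Poly_seq_mul coef_Poly.
Qed.

(** With [W = X3 + b X2], the polynomials [Q] and [B] in [b] are [E W^2] and [2 E (X1 W)]. The
    constant [4 / 135] is [2^9 / (6! 4!)]. *)
Lemma coef6_isserlis (R : realFieldType) (s1 s2 s3 c12 c13 c23 : R) :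
  let Q := Poly [:: s3; 2 * c23; s2] in
  let B := Poly [:: 2 * c13; 2 * c12] in
  (14 * s1 ^+ 4 *: Q ^+ 5 + 140 * s1 ^+ 3 *: (B ^+ 2 * Q ^+ 4) +
   140 * s1 ^+ 2 *: (B ^+ 4 * Q ^+ 3) + 28 * s1 *: (B ^+ 6 * Q ^+ 2) +
   B ^+ 8 * Q)`_6 = 4 / 135 * isserlis864 s1 s2 s3 c12 c13 c23.
Proof.
move=> Q B.
(* The outer summands are put in the common shape [B ^+ m * Q ^+ n]. *)
rewrite -[Q ^+ 5]mul1r -[X in X * Q ^+ 5](expr0 B) -[X in B ^+ 8 * X]expr1.
rewrite !coefD !coefZ !coef_Poly_expM /isserlis864 /=.
by field.
Qed.

Section mixed_moment.
Context d (T : measurableType d) (R : realType) (P : probability T R).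

(** The binomial theorem under the integral, with [n!] distributed over the coefficients. The weight
    [Z] is 1 when extracting powers of [X1], and [X1 ^+ 8] when extracting powers of [X2]. *)
Lemma moment_expansion (Z X W : T -> R) n (x : R) :
  all_moments P Z -> all_moments P X -> all_moments P W ->
  (\int[P]_w (Z w * (W w + x * X w) ^+ n)) / n`!%:R =
  \sum_(i < n.+1)
    (\int[P]_w (Z w * X w ^+ i * W w ^+ (n - i))) / (i`!%:R * (n - i)`!%:R) *
    x ^+ i.
Proof.
move=> mZ mX mW.
have mterm i : all_moments P (fun w => Z w * X w ^+ i * W w ^+ (n - i)).
  by apply: all_momentsM; [apply: all_momentsM => //|]; exact: all_momentsX.
have int_term i : P.-integrable setT
    (EFin \o fun w => x ^+ i *+ 'C(n, i) * (Z w * X w ^+ i * W w ^+ (n - i))).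
  rewrite /comp; under eq_fun do rewrite EFinM.
  by apply: integrableZl => //; exact: all_moments_integrable.
have eqZ w : Z w * (W w + x * X w) ^+ n = \sum_(i < n.+1)
    x ^+ i *+ 'C(n, i) * (Z w * X w ^+ i * W w ^+ (n - i)).
  rewrite exprDn mulr_sumr; apply: eq_bigr => i _.
  by rewrite mulrnAl mulrnAr exprMn; congr (_ *+ _); ring.
under eq_Rintegral do rewrite eqZ.
rewrite (Rintegral_sum (f := fun i w =>
  x ^+ i *+ 'C(n, i) * (Z w * X w ^+ i * W w ^+ (n - i))))//.
rewrite mulr_suml; apply: eq_bigr => i _.
rewrite RintegralZl//; last exact: all_moments_integrable.
have fact_neq0 k : k`!%:R != 0 :> R by rewrite pnatr_eq0 -lt0n fact_gt0.
have := bin_fact (ltn_ord i : i <= n)%N => /(congr1 (fun k => k%:R : R)).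
rewrite -mulr_natr !natrM => <-.
have : 'C(n, i)%:R != 0 :> R by rewrite pnatr_eq0 -lt0n bin_gt0 -ltnS.
by move=> C0; field; rewrite C0 !fact_neq0.
Qed.

(* Both sides of [E (W + x X)^18 = 17!! (E (W + x X)^2)^9] are polynomials in
   [x]; the identity compares the coefficients of [x^8]. *)
Lemma moment_8_10 (X W : T -> R) (v u q : R) :
  all_moments P X -> all_moments P W ->
  (forall x, measurable_fun [set: T] (fun w => W w + x * X w)) ->
  (forall x, centered_gaussian_or_zero P (fun w => W w + x * X w)) ->
  (forall x, \int[P]_w ((W w + x * X w) ^+ 2) = q + 2 * u * x + v * x ^+ 2) ->
  (\int[P]_w (X w ^+ 8 * W w ^+ 10)) / (8`!%:R * 10`!%:R) =
  (14 * v ^+ 4 * q ^+ 5 + 140 * v ^+ 3 * (2 * u) ^+ 2 * q ^+ 4 +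
   140 * v ^+ 2 * (2 * u) ^+ 4 * q ^+ 3 + 28 * v * (2 * u) ^+ 6 * q ^+ 2 +
   (2 * u) ^+ 8 * q) / (8`!%:R * 2 ^+ 9).
Proof.
move=> mX mW mY gY varY.
pose p := (2 ^+ 9 * 9`!%:R)^-1 *: (q%:P + (2 * u) *: 'X + v *: 'X^2) ^+ 9.
pose c i := (\int[P]_w (1 * X w ^+ i * W w ^+ (18 - i))) /
   (i`!%:R * (18 - i)`!%:R).
have m1 : all_moments P (cst 1).
  by split=> // n; under eq_fun do rewrite expr1n; exact: finite_measure_integrable_cst.
have hc x : \sum_(i < 19) c i * x ^+ i = p.[x].
  rewrite -(moment_expansion 18 x m1 mX mW).
  under eq_Rintegral do rewrite mul1r.
  have := gaussian_moment_even (mY x) (gY x) 9; rewrite varY => ->.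
  rewrite /p hornerZ horner_exp !(hornerD, hornerC, hornerZ, hornerX, hornerXn).
  have f0 : 9`!%:R != 0 :> R by rewrite pnatr_eq0 -lt0n fact_gt0.
  by move: (9`!%:R) f0 => f f0; field.
have := coef_eq_of_horner hc (isT : (8 < 19)%N).
rewrite /p coefZ coef8_trinomial_exp9 /c.
under eq_Rintegral do rewrite mul1r.
move=> ->; rewrite factS natrM.
have f0 : 8`!%:R != 0 :> R by rewrite pnatr_eq0 -lt0n fact_gt0.
by move: (8`!%:R) f0 => f f0; field.
Qed.

End mixed_moment.

Section gaussian_vector.
Context d (T : measurableType d) (R : realType) (P : probability T R).
Variables X1 X2 X3 : {RV P >-> R}.
Hypothesis gX : centered_gaussian_vector3 X1 X2 X3.

Lemma measurable_lincomb (a b c : R) :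
  measurable_fun [set: T] (fun w => a * X1 w + b * X2 w + c * X3 w).
Proof. by do !apply: measurable_funD; apply: measurable_funM. Qed.

Lemma gaussian_vector_marginals :
  [/\ centered_gaussian_or_zero P X1, centered_gaussian_or_zero P X2
    & centered_gaussian_or_zero P X3].
Proof.
split.
- have := gX 1 0 0; congr centered_gaussian_or_zero.
  by apply/funext => w; rewrite !mul0r !addr0 mul1r.
- have := gX 0 1 0; congr centered_gaussian_or_zero.
  by apply/funext => w; rewrite !mul0r add0r addr0 mul1r.
- have := gX 0 0 1; congr centered_gaussian_or_zero.
  by apply/funext => w; rewrite !mul0r !add0r mul1r.
Qed.

Lemma gaussian_vector_all_moments :
  [/\ all_moments P X1, all_moments P X2 & all_moments P X3].
Proof.
have [g1 g2 g3] := gaussian_vector_marginals.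
by split; exact: gaussian_all_moments.
Qed.

Let v1 := \int[P]_w (X1 w ^+ 2).
Let v2 := \int[P]_w (X2 w ^+ 2).
Let v3 := \int[P]_w (X3 w ^+ 2).
Let c12 := \int[P]_w (X1 w * X2 w).
Let c13 := \int[P]_w (X1 w * X3 w).
Let c23 := \int[P]_w (X2 w * X3 w).

Lemma variance_lincomb (a b c : R) :
  \int[P]_w ((a * X1 w + b * X2 w + c * X3 w) ^+ 2) =
  a ^+ 2 * v1 + b ^+ 2 * v2 + c ^+ 2 * v3 +
  2 * a * b * c12 + 2 * a * c * c13 + 2 * b * c * c23.
Proof.
have [m1 m2 m3] := gaussian_vector_all_moments.
have iZ (k : R) f : all_moments P f -> P.-integrable setT (EFin \o fun w => k * f w).
  move=> mf; rewrite /comp; under eq_fun do rewrite EFinM.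
  by apply: integrableZl => //; exact: all_moments_integrable.
have iD (f g : T -> R) : P.-integrable setT (EFin \o f) ->
    P.-integrable setT (EFin \o g) -> P.-integrable setT (EFin \o fun w => f w + g w).
  by move=> fi gi; exact: (integrableD measurableT fi gi).
have E w : (a * X1 w + b * X2 w + c * X3 w) ^+ 2 =
  a ^+ 2 * X1 w ^+ 2 + b ^+ 2 * X2 w ^+ 2 + c ^+ 2 * X3 w ^+ 2 +
  2 * a * b * (X1 w * X2 w) + 2 * a * c * (X1 w * X3 w) +
  2 * b * c * (X2 w * X3 w) by ring.
under eq_Rintegral do rewrite E.
have i1 := iZ (a ^+ 2) _ (all_momentsX 2 m1).
have i2 := iZ (b ^+ 2) _ (all_momentsX 2 m2).
have i3 := iZ (c ^+ 2) _ (all_momentsX 2 m3).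
have i12 := iZ (2 * a * b) _ (all_momentsM m1 m2).
have i13 := iZ (2 * a * c) _ (all_momentsM m1 m3).
have i23 := iZ (2 * b * c) _ (all_momentsM m2 m3).
have j2 := iD _ _ i1 i2; have j3 := iD _ _ j2 i3.
have j4 := iD _ _ j3 i12; have j5 := iD _ _ j4 i13.
rewrite !RintegralD// !RintegralZl//; apply: all_moments_integrable;
  by [exact: all_momentsX | exact: all_momentsM].
Qed.

(** For each [b], [moment_8_10] applied to [X1] and [X3 + b X2] gives a moment that is polynomial in
    [b]; its coefficient of [b^6] isolates the desired one. *)
Lemma mixed_moment_864 :
  \int[P]_w (X1 w ^+ 8 * X2 w ^+ 6 * X3 w ^+ 4) =
  isserlis864 v1 v2 v3 c12 c13 c23.
Proof.
have [m1 m2 m3] := gaussian_vector_all_moments.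
pose Q := Poly [:: v3; 2 * c23; v2].
pose B := Poly [:: 2 * c13; 2 * c12].
pose p := (2 ^+ 9)^-1 *:
  (14 * v1 ^+ 4 *: Q ^+ 5 + 140 * v1 ^+ 3 *: (B ^+ 2 * Q ^+ 4) +
   140 * v1 ^+ 2 *: (B ^+ 4 * Q ^+ 3) + 28 * v1 *: (B ^+ 6 * Q ^+ 2) +
   B ^+ 8 * Q).
pose c i := (\int[P]_w (X1 w ^+ 8 * X2 w ^+ i * X3 w ^+ (10 - i))) /
   (i`!%:R * (10 - i)`!%:R).
have hc b : \sum_(i < 11) c i * b ^+ i = p.[b].
  rewrite -(moment_expansion 10 b (all_momentsX 8 m1) m2 m3).
  have WE : (fun w => X3 w + b * X2 w) =
      (fun w => 0 * X1 w + b * X2 w + 1 * X3 w).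
    by apply/funext => w; ring.
  have YE x : (fun w => (X3 w + b * X2 w) + x * X1 w) =
      (fun w => x * X1 w + b * X2 w + 1 * X3 w).
    by apply/funext => w; ring.
  have mW : all_moments P (fun w => X3 w + b * X2 w).
    by rewrite WE; exact: gaussian_all_moments (measurable_lincomb _ _ _) (gX _ _ _).
  have mY x : measurable_fun setT (fun w => (X3 w + b * X2 w) + x * X1 w).
    by rewrite YE; exact: measurable_lincomb.
  have gY x : centered_gaussian_or_zero P (fun w => (X3 w + b * X2 w) + x * X1 w).
    by rewrite YE; exact: gX.
  have vY x : \int[P]_w ((X3 w + b * X2 w + x * X1 w) ^+ 2) =
      (v3 + 2 * c23 * b + v2 * b ^+ 2) + 2 * (c13 + b * c12) * x + v1 * x ^+ 2.
    under eq_Rintegral do rewrite [X in X ^+ 2](congr1 (@^~ _) (YE x)).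
    by rewrite variance_lincomb; ring.
  have h := moment_8_10 m1 mW mY gY vY.
  rewrite /p !(hornerD, hornerZ) ![(B ^+ _ * _).[b]]hornerM !horner_exp.
  rewrite !horner_Poly /=.
  rewrite !mul0r !add0r.
  have f0 n : n`!%:R != 0 :> R by rewrite pnatr_eq0 -lt0n fact_gt0.
  have := f0 8; have := f0 10.
  move: h; move: (8`!%:R : R) (10`!%:R : R) => f8 f10; move: (Rintegral _ _ _) => e.
  move=> h n10 n8; have -> : e = (e / (f8 * f10)) * (f8 * f10).
    by field; rewrite n8 n10.
  rewrite h; field.
  by rewrite n8 n10.
have := coef_eq_of_horner hc (isT : (6 < 11)%N).
rewrite /p coefZ coef6_isserlis /c.
have -> : (6`!%:R * (10 - 6)`!%:R : R) = 720 * 24 by rewrite -!natrM.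
by move: (Rintegral _ _ _) => e h; lra.
Qed.

End gaussian_vector.

(** * Vanishing covariances imply independence *)

(** This is the derivative of sine at 0 along [y / n.+1]; [y = 0] is separate because the difference
    quotient needs a punctured neighbourhood. *)
Lemma cvg_mul_sin_div (R : realType) (y : R) :
  n.+1%:R * sin (y / n.+1%:R) @[n --> \oo] --> y.
Proof.
have [->|y0] := eqVneq y 0.
  apply: cvg_near_cst; apply: nearW => n.
  by rewrite mul0r sin0 mulr0.
have sin' : h^-1 * sin h @[h --> 0^'] --> (1 : R).
  have [dsin] := is_derive_sin (0 : R); rewrite cos0 => <-.
  have := dsin; rewrite /derivable /derive => /cvgP.
  apply: cvg_trans; apply: near_eq_cvg; apply: nearW => h /=.
  by rewrite /GRing.scale /= sin0 subr0 addr0 mulr1.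
have yn : y / n.+1%:R @[n --> \oo] --> (0 : R)^'.
  have yn0 : y / n.+1%:R @[n --> \oo] --> (0 : R).
    by rewrite -[X in _ --> X](mulr0 y); apply: cvgMl_tmp; exact: cvg_harmonic.
  move=> A /yn0 [N _ hN]; exists N => // n /= /hN /=; apply.
  by rewrite mulf_neq0// invr_neq0.
have := cvg_comp _ _ yn sin' => /(cvgM (cvg_cst y)); rewrite mulr1.
apply: cvg_trans; apply: near_eq_cvg; apply: nearW => n /=.
by rewrite invfM invrK !mulrA mulfV// mul1r.
Qed.

(** Forces a bump to 0 where [a * K] is large; [bernoulli_ge] forces it to 1 where [a * K] is
    small. *)
Lemma bernoulli_le1 (R : realDomainType) (a : R) K : 0 <= a -> a <= 1 ->
  (1 - a) ^+ K * (1 + a * K%:R) <= 1.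
Proof.
move=> a0 a1; elim: K => [|K IH]; first by rewrite expr0 mulr0 addr0 mulr1.
apply: le_trans IH; rewrite exprSr -mulrA ler_wpM2l ?exprn_ge0 ?subr_ge0//.
have K0 := ler0n R K; rewrite -natr1; nra.
Qed.

Lemma bernoulli_ge (R : realDomainType) (a : R) K : 0 <= a -> a <= 1 ->
  1 - a * K%:R <= (1 - a) ^+ K.
Proof.
move=> a0 a1; elim: K => [|K IH]; first by rewrite expr0 mulr0 subr0.
rewrite exprSr; apply: (@le_trans _ _ ((1 - a * K%:R) * (1 - a))).
  have K0 := ler0n R K; rewrite -natr1; nra.
by rewrite ler_wpM2r ?subr_ge0.
Qed.

(* A trigonometric polynomial in [y] which, [n.+1 * sin (y / n.+1)] being close
   to [y], behaves like [(1 - y ^ (2 n) / N) ^ N] with [N = n.+1 ^ (2 n)], hence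
   converges to the indicator of ]-1, 1[ away from the endpoints. *)
Definition bump (R : realType) n (y : R) : R :=
  (1 - (sin (y / n.+1%:R) ^+ 2) ^+ n) ^+ ((n.+1 ^ 2) ^ n).

Lemma bump_arg_itv (R : realType) n (y : R) :
  0 <= (sin (y / n.+1%:R) ^+ 2) ^+ n <= 1.
Proof.
rewrite exprn_ge0 ?sqr_ge0//= exprn_ile1 ?sqr_ge0//.
Qed.

Lemma bump_itv (R : realType) n (y : R) : 0 <= bump n y <= 1.
Proof.
have /andP[a0 a1] := bump_arg_itv n y.
by rewrite /bump exprn_ge0 ?subr_ge0//= exprn_ile1 ?subr_ge0// lerBlDr lerDl.
Qed.

(** Here [a * K] equals [w n ^+ n] with [w n] tending to [y ^+ 2], so it decays or grows
    geometrically according to the side of 1 on which [y ^+ 2] lies. The ratio [r] is the midpoint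
    of [y ^+ 2] and 1. *)
Lemma cvg_bump (R : realType) (y : R) : `|y| != 1 ->
  bump n y @[n --> \oo] --> ((`|y| < 1)%R%:R : R).
Proof.
move=> y1; pose w n := (n.+1%:R * sin (y / n.+1%:R)) ^+ 2.
have cw : w n @[n --> \oo] --> y ^+ 2.
  by apply: cvgM; exact: cvg_mul_sin_div.
have wE n : (sin (y / n.+1%:R) ^+ 2) ^+ n * ((n.+1 ^ 2) ^ n)%:R = w n ^+ n.
  by rewrite !natrX -!exprMn mulrC.
have w0 n : 0 <= w n ^+ n by rewrite exprn_ge0 ?sqr_ge0.
have le1 n : bump n y * (1 + w n ^+ n) <= 1.
  by have /andP[a0 a1] := bump_arg_itv n y; rewrite -wE; exact: bernoulli_le1.
have ge1 n : 1 - w n ^+ n <= bump n y.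
  by have /andP[a0 a1] := bump_arg_itv n y; rewrite -wE; exact: bernoulli_ge.
have [yl|yl] := ltP `|y| 1.
  have y2 : y ^+ 2 < 1 by rewrite -real_normK ?num_real// expr_lt1.
  pose r := (y ^+ 2 + 1) / 2.
  have r1 : r < 1 by rewrite /r; lra.
  have r0 : 0 <= r by rewrite /r; have := sqr_ge0 y; lra.
  have near_r : \forall n \near \oo, w n <= r.
    by apply: (cvgr_le _ cw); rewrite /r; lra.
  apply: (@squeeze_cvgr _ _ _ _ (fun n => 1 - r ^+ n) (cst 1)).
  - near=> n; apply/andP; split; last by have /andP[] := bump_itv n y.
    apply: le_trans (ge1 n); rewrite lerB// lerXn2r ?nnegrE ?sqr_ge0//.
    by near: n.
  - rewrite -[X in _ --> X]subr0; apply: cvgB; first exact: cvg_cst.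
    by apply: cvg_expr; rewrite ger0_norm.
  - exact: cvg_cst.
have y2 : 1 < y ^+ 2.
  rewrite -real_normK ?num_real// expr_gt1//.
  by rewrite lt_neqAle eq_sym y1.
pose r := (y ^+ 2 + 1) / 2.
have r1 : 1 < r by rewrite /r; lra.
have near_r : \forall n \near \oo, r <= w n.
  by apply: (cvgr_ge _ cw); rewrite /r; lra.
apply: (@squeeze_cvgr _ _ _ _ (cst 0) (fun n => r^-1 ^+ n)).
- near=> n; apply/andP; split; first by have /andP[] := bump_itv n y.
  have rn : r ^+ n <= w n ^+ n.
    rewrite lerXn2r ?nnegrE ?sqr_ge0//; first by rewrite ltW// (lt_trans _ r1).
    by near: n.
  have rn0 : 0 < r ^+ n by rewrite exprn_gt0// (lt_trans _ r1).
  have /andP[b0 _] := bump_itv n y.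
  rewrite exprVn -[leRHS]mul1r ler_pdivlMr//; apply: le_trans (le1 n).
  by rewrite ler_wpM2l//; apply: le_trans rn _; rewrite lerDr.
- exact: cvg_cst.
- apply: cvg_expr; rewrite ger0_norm ?invf_lt1// ?invr_ge0; last first.
    by rewrite ltW// (lt_trans _ r1).
  by rewrite (lt_trans _ r1).
Unshelve. all: by end_near. Qed.

(* The triple [(a, t, p)] stands for the wave [a * cos (t * x + p)]. *)
Definition trig_poly (R : realType) (f : R -> R) :=
  exists s : seq (R * R * R), forall x,
    f x = \sum_(k <- s) k.1.1 * cos (k.1.2 * x + k.2).

Section trig_poly_theory.
Context {R : realType}.
Implicit Types f g : R -> R.

Lemma trig_poly_cos (t p : R) : trig_poly (fun x => cos (t * x + p)).
Proof. by exists [:: (1, t, p)] => x; rewrite big_seq1 mul1r. Qed.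

Lemma trig_poly_cst (a : R) : trig_poly (fun=> a).
Proof. by exists [:: (a, 0, 0)] => x; rewrite big_seq1 mul0r addr0 cos0 mulr1. Qed.

Lemma trig_polyD f g : trig_poly f -> trig_poly g ->
  trig_poly (fun x => f x + g x).
Proof.
by move=> [s fE] [t gE]; exists (s ++ t) => x; rewrite big_cat /= fE gE.
Qed.

Lemma trig_polyM f g : trig_poly f -> trig_poly g ->
  trig_poly (fun x => f x * g x).
Proof.
move=> [s fE] [t gE].
exists ([seq (k.1.1 * l.1.1 / 2, k.1.2 + l.1.2, k.2 + l.2) | k <- s, l <- t] ++
  [seq (k.1.1 * l.1.1 / 2, k.1.2 - l.1.2, k.2 - l.2) | k <- s, l <- t]) => x.
rewrite big_cat !big_allpairs_dep /= -big_split /= fE gE mulr_suml.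
apply: eq_bigr => k _; rewrite -big_split /= mulr_sumr; apply: eq_bigr => l _.
have -> : (k.1.2 + l.1.2) * x + (k.2 + l.2) =
  (k.1.2 * x + k.2) + (l.1.2 * x + l.2) by ring.
have -> : (k.1.2 - l.1.2) * x + (k.2 - l.2) =
  (k.1.2 * x + k.2) - (l.1.2 * x + l.2) by ring.
by rewrite (cosD (k.1.2 * x + k.2)) (cosB (k.1.2 * x + k.2)); field.
Qed.

Lemma trig_polyX f n : trig_poly f -> trig_poly (fun x => f x ^+ n).
Proof.
move=> tf; elim: n => [|n IH]; first exact: trig_poly_cst.
have -> : (fun x => f x ^+ n.+1) = (fun x => f x * f x ^+ n).
  by apply/funext => x; rewrite exprS.
exact: trig_polyM.
Qed.

Lemma trig_poly_bump (c h : R) n : trig_poly (fun x => bump n ((x - c) / h)).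
Proof.
rewrite /bump; apply/trig_polyX.
(* The sine is a cosine wave of phase shifted by [- pi / 2]. *)
have sinE x : sin ((x - c) / h / n.+1%:R) =
    cos ((h * n.+1%:R)^-1 * x + (- (c / (h * n.+1%:R)) - pi / 2)).
  rewrite addrA cosB cos_pihalf sin_pihalf mulr0 add0r mulr1; congr sin.
  by rewrite invfM; ring.
have -> : (fun x => 1 - (sin ((x - c) / h / n.+1%:R) ^+ 2) ^+ n) = (fun x =>
    1 + -1 * (cos ((h * n.+1%:R)^-1 * x +
      (- (c / (h * n.+1%:R)) - pi / 2)) ^+ 2) ^+ n).
  by apply/funext => x; rewrite sinE mulN1r.
apply: trig_polyD; first exact: trig_poly_cst.
apply: trig_polyM; first exact: trig_poly_cst.
by do 2 apply: trig_polyX; exact: trig_poly_cos.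
Qed.

End trig_poly_theory.

Section bounded_variables.
Context d (T : measurableType d) (R : realType) (P : probability T R).

Definition bounded_var (f : T -> R) :=
  measurable_fun [set: T] f /\ exists C, forall w, `|f w| <= C.

Lemma bounded_var_integrable f : bounded_var f ->
  P.-integrable [set: T] (EFin \o f).
Proof.
move=> [mf [C fC]].
apply: (le_integrable measurableT (g := EFin \o cst C)).
- exact/measurable_EFinP.
- by move=> w _ /=; rewrite lee_fin (le_trans (fC w)) ?ler_norm.
- exact: finite_measure_integrable_cst.
Qed.

Lemma bounded_var_cos (X : T -> R) (t p : R) : measurable_fun [set: T] X ->
  bounded_var (fun w => cos (t * X w + p)).
Proof.
move=> mX; split; last by exists 1 => w; exact: cos_max.
apply: (measurableT_comp (f := cos)).
  exact: continuous_measurable_fun (@continuous_cos R).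
by apply: measurable_funD => //; exact: measurable_funM.
Qed.

Lemma bounded_varM f g : bounded_var f -> bounded_var g ->
  bounded_var (fun w => f w * g w).
Proof.
move=> [mf [C fC]] [mg [D gD]]; split; first exact: measurable_funM.
by exists (C * D) => w; rewrite normrM ler_pM.
Qed.

Lemma bounded_varD f g : bounded_var f -> bounded_var g ->
  bounded_var (fun w => f w + g w).
Proof.
move=> [mf [C fC]] [mg [D gD]]; split; first exact: measurable_funD.
by exists (C + D) => w; rewrite (le_trans (ler_normD _ _))// lerD.
Qed.

Lemma bounded_var_cst (a : R) : bounded_var (fun=> a).
Proof. by split=> //; exists `|a|. Qed.

Lemma bounded_var_trig_poly (X : T -> R) f : measurable_fun [set: T] X ->
  trig_poly f -> bounded_var (fun w => f (X w)).
Proof.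
move=> mX [s fE]; under eq_fun do rewrite fE.
elim: s {fE} => [|k s IH].
  by under eq_fun do rewrite big_nil; exact: bounded_var_cst.
under eq_fun do rewrite big_cons; apply: bounded_varD => //.
by apply: bounded_varM; [exact: bounded_var_cst|exact: bounded_var_cos].
Qed.

(** Linearity extends factorisation from single waves to trigonometric polynomials. As [g] is any
    bounded variable, the lemma can be applied to one coordinate after another. *)
Lemma trig_poly_factor (X : T -> R) (g : T -> R) (K : R) f :
  measurable_fun [set: T] X -> bounded_var g ->
  (forall t p, \int[P]_w (cos (t * X w + p) * g w) =
               (\int[P]_w cos (t * X w + p)) * K) ->
  trig_poly f ->
  \int[P]_w (f (X w) * g w) = (\int[P]_w f (X w)) * K.
Proof.
move=> mX bg Hcos [s fE].
under eq_Rintegral do rewrite fE; under [in RHS]eq_Rintegral do rewrite fE.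
elim: s {fE} => [|k s IH].
  under eq_Rintegral do rewrite big_nil mul0r.
  under [in RHS]eq_Rintegral do rewrite big_nil.
  by rewrite Rintegral_cst// !mul0r.
have bk : bounded_var (fun w => k.1.1 * cos (k.1.2 * X w + k.2)).
  by apply: bounded_varM; [exact: bounded_var_cst|exact: bounded_var_cos].
have bs : bounded_var (fun w => \sum_(k <- s) k.1.1 * cos (k.1.2 * X w + k.2)).
  apply: (bounded_var_trig_poly mX
    (f := fun x => \sum_(k <- s) k.1.1 * cos (k.1.2 * x + k.2))).
  by exists s.
under eq_Rintegral do rewrite big_cons mulrDl.
under [in RHS]eq_Rintegral do rewrite big_cons.
rewrite (RintegralD measurableT (bounded_var_integrable (bounded_varM bk bg))
  (bounded_var_integrable (bounded_varM bs bg))).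
rewrite (RintegralD measurableT (bounded_var_integrable bk)
  (bounded_var_integrable bs)) IH mulrDl; congr (_ + _).
have bc := bounded_var_cos k.1.2 k.2 mX.
under eq_Rintegral do rewrite -mulrA.
rewrite (RintegralZl _ measurableT (bounded_var_integrable (bounded_varM bc bg))).
by rewrite (RintegralZl _ measurableT (bounded_var_integrable bc)) Hcos mulrA.
Qed.

End bounded_variables.

(** Open intervals form a generating family stable under intersection, and the symmetric ones
    exhaust the line with finite mass. *)
Lemma measure_itv_oo_unique (R : realType) (m1 m2 : {measure set R -> \bar R}) :
  (forall n : nat, (m1 `](- n%:R)%R, n%:R%R[%classic < +oo)%E) ->
  (forall a b : R, a < b -> m1 `]a, b[%classic = m2 `]a, b[%classic) ->
  forall A : set R, measurable A -> m1 A = m2 A.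
Proof.
move=> fin1 m12; pose G : set (set R) := [set A | exists a b, A = `]a, b[%classic].
apply: (measure_unique G (fun n : nat => `]- n%:R, n%:R[%classic)).
- exact: RGenOpens.measurableE.
- move=> _ _ [a [b ->]] [a' [b' ->]]; exists (Order.max a a'), (Order.min b b').
  apply/seteqP; split => x /=; rewrite !in_itv /= gt_max lt_min.
    by move=> [/andP[-> ->] /andP[-> ->]].
  by move=> /andP[/andP[-> ->] /andP[-> ->]].
- by move=> n; exists (- n%:R), n%:R.
- apply/seteqP; split => x // _; have [n xn] : exists n : nat, `|x| < n%:R.
    by exists (Num.bound `|x|); exact: archi_boundP.
  by exists n => //=; rewrite in_itv /= -ltr_norml.
- move=> _ [a [b ->]]; have [ab|ba] := ltP a b; first exact: m12.
  by rewrite set_itv_ge ?measure0// bnd_simp -leNgt.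
- exact: fin1.
Qed.

Section law_factor.
Context d (T : measurableType d) (R : realType) (P : probability T R).

(** Both sides are finite measures in [A]. Since [B] is an arbitrary event, intervals can be
    replaced by Borel sets one coordinate at a time. *)
Lemma preimage_itv_oo_factor (X : {RV P >-> R}) (B : set T) (r : R) :
  measurable B -> 0 <= r ->
  (forall a b : R, a < b ->
    P (X @^-1` `]a, b[ `&` B) = (P (X @^-1` `]a, b[) * r%:E)%E) ->
  forall A : set R, measurable A ->
    P (X @^-1` A `&` B) = (P (X @^-1` A) * r%:E)%E.
Proof.
move=> mB r0 h A mA.
pose m1 := pushforward (mrestr P mB) X.
pose m2 := mscale (NngNum r0) (distribution P X).
rewrite [RHS]muleC; apply: (@measure_itv_oo_unique R m1 m2) => //.
- move=> n; rewrite /m1 /pushforward /mrestr.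
  apply: le_lt_trans (probability_le1 _ _) (ltry _).
  by apply: measurableI => //; exact: measurable_funPTI.
- by move=> a b ab; rewrite /m1 /m2 /mscale /= /pushforward /mrestr h// muleC.
Qed.

End law_factor.

Section uncorrelated.
Context d (T : measurableType d) (R : realType) (P : probability T R).

Lemma nondeg_gaussian_no_atom (X : T -> R) y : nondeg_centered_gaussian P X ->
  P (X @^-1` [set y]) = 0%E.
Proof.
move=> [s [_ lawX]]; rewrite lawX//.
by rewrite /normal_prob integral_set1.
Qed.

Lemma nondeg_gaussian_ae_neq (X : {RV P >-> R}) y :
  nondeg_centered_gaussian P X -> {ae P, forall w, X w != y}.
Proof.
move=> gX; exists (X @^-1` [set y]); split.
- exact: measurable_funPTI.
- exact: nondeg_gaussian_no_atom.
- by move=> w /= /negP; rewrite negbK => /eqP.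
Qed.

(** The affine map sends []a, b[] to []-1, 1[]; the excluded endpoints are null for a law without
    atoms. *)
Lemma cvg_bump_itv (a b x : R) : a < b -> x != a -> x != b ->
  bump n ((x - (a + b) / 2) / ((b - a) / 2)) @[n --> \oo] -->
  (\1_(`]a, b[%classic : set R) x : R).
Proof.
move=> ab xa xb; have h0 : 0 < (b - a) / 2 by lra.
have -> : \1_(`]a, b[%classic : set R) x =
    (`|(x - (a + b) / 2) / ((b - a) / 2)| < 1)%R%:R :> R.
  rewrite indicE mem_setE in_itv /= normrM normfV (gtr0_norm h0).
  rewrite ltr_pdivrMr// mul1r ltr_norml; congr ((nat_of_bool _)%:R).
  by apply/idP/idP => /andP[? ?]; apply/andP; split; lra.
apply: cvg_bump; rewrite normrM normfV (gtr0_norm h0).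
apply/eqP => /(congr1 (fun z => z * ((b - a) / 2))).
rewrite mulfVK ?gt_eqF// mul1r; case: (ger0P (x - (a + b) / 2)) => _ e.
  by move/eqP: xb; apply; lra.
by move/eqP: xa; apply; lra.
Qed.

Lemma Rintegral_indic (A : set T) : measurable A ->
  \int[P]_w \1_A w = fine (P A).
Proof. by move=> mA; rewrite /Rintegral integral_indic// setIT. Qed.

Variables X1 X2 X3 : {RV P >-> R}.
Hypothesis gX : centered_gaussian_vector3 X1 X2 X3.
Hypothesis c12 : \int[P]_w (X1 w * X2 w) = 0.
Hypothesis c13 : \int[P]_w (X1 w * X3 w) = 0.
Hypothesis c23 : \int[P]_w (X2 w * X3 w) = 0.

Local Notation v1 := (\int[P]_w (X1 w ^+ 2)).
Local Notation v2 := (\int[P]_w (X2 w ^+ 2)).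
Local Notation v3 := (\int[P]_w (X3 w ^+ 2)).

(** Expanding the phase leaves a cosine term, given by the characteristic function, and a sine term
    of mean zero. Vanishing covariances make the variance a sum of three squares. *)
Lemma Rintegral_cos_lincomb (a b c p : R) :
  \int[P]_w cos (a * X1 w + b * X2 w + c * X3 w + p) =
  cos p * expR (- ((a ^+ 2 * v1 + b ^+ 2 * v2 + c ^+ 2 * v3) / 2)).
Proof.
have mL := measurable_lincomb X1 X2 X3 a b c.
have bcos : bounded_var (fun w => cos (a * X1 w + b * X2 w + c * X3 w)).
  rewrite (_ : (fun w => _) =
    fun w => cos (1 * (a * X1 w + b * X2 w + c * X3 w) + 0)).
    exact: bounded_var_cos.
  by apply/funext => w; rewrite mul1r addr0.
have bsin : bounded_var (fun w => sin (a * X1 w + b * X2 w + c * X3 w)).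
  split; last by exists 1 => w; exact: sin_max.
  apply: (measurableT_comp (f := sin)) => //.
  exact: continuous_measurable_fun (@continuous_sin R).
under eq_Rintegral do rewrite cosD mulrC [X in _ - X]mulrC -mulNr.
have ib f (k : R) : bounded_var f -> P.-integrable setT (EFin \o fun w => k * f w).
  by move=> bf; apply/bounded_var_integrable/bounded_varM => //; exact: bounded_var_cst.
rewrite (RintegralD measurableT (ib _ (cos p) bcos) (ib _ (- sin p) bsin)).
rewrite !RintegralZl//; do ?exact: bounded_var_integrable.
rewrite (gaussian_sin mL (gX a b c)) mulr0 addr0.
rewrite (gaussian_cos mL (gX a b c)) variance_lincomb// c12 c13 c23.
by rewrite !mulr0 !addr0.
Qed.

Lemma cosM3 (A B C : R) : cos A * (cos B * cos C) =
  (cos (A + B + C) + cos (A + B - C) + cos (A - B + C) + cos (A - B - C)) / 4.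
Proof. by rewrite !(cosD, sinD, cosN, sinN); field. Qed.

Lemma Rintegral_cos1 (a p : R) :
  \int[P]_w cos (a * X1 w + p) = cos p * expR (- ((a ^+ 2 * v1) / 2)).
Proof.
have := Rintegral_cos_lincomb a 0 0 p; rewrite !expr0n /= !mul0r !addr0 => <-.
by apply: eq_Rintegral => w _; rewrite !mul0r !addr0.
Qed.

Lemma Rintegral_cos2 (a p : R) :
  \int[P]_w cos (a * X2 w + p) = cos p * expR (- ((a ^+ 2 * v2) / 2)).
Proof.
have := Rintegral_cos_lincomb 0 a 0 p; rewrite !expr0n /= !mul0r add0r addr0 => <-.
by apply: eq_Rintegral => w _; rewrite !mul0r add0r addr0.
Qed.

Lemma Rintegral_cos3 (a p : R) :
  \int[P]_w cos (a * X3 w + p) = cos p * expR (- ((a ^+ 2 * v3) / 2)).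
Proof.
have := Rintegral_cos_lincomb 0 0 a p; rewrite !expr0n /= !mul0r !add0r => <-.
by apply: eq_Rintegral => w _; rewrite !mul0r !add0r.
Qed.

(** The product splits into four waves differing in the signs of [b] and [c]. All four carry the
    same Gaussian factor, which depends on squares only, and the phases recombine by [cosM3]. *)
Lemma Rintegral_cosM3 (a p b q c r : R) :
  \int[P]_w (cos (a * X1 w + p) * (cos (b * X2 w + q) * cos (c * X3 w + r))) =
  (\int[P]_w cos (a * X1 w + p)) *
  ((\int[P]_w cos (b * X2 w + q)) * (\int[P]_w cos (c * X3 w + r))).
Proof.
pose L (e f g h : R) w := cos (e * X1 w + f * X2 w + g * X3 w + h).
have bL e f g h : P.-integrable setT (EFin \o L e f g h).
  apply: bounded_var_integrable.
  rewrite (_ : L e f g h =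
    fun w => cos (1 * (e * X1 w + f * X2 w + g * X3 w) + h)).
    by apply: bounded_var_cos; exact: measurable_lincomb.
  by apply/funext => w; rewrite mul1r.
have E w : cos (a * X1 w + p) * (cos (b * X2 w + q) * cos (c * X3 w + r)) =
    4^-1 * (L a b c (p + q + r) w + L a b (- c) (p + q - r) w +
     L a (- b) c (p - q + r) w + L a (- b) (- c) (p - q - r) w).
  by rewrite cosM3 mulrC; congr (_ * (cos _ + cos _ + cos _ + cos _)); ring.
under eq_Rintegral do rewrite E.
have iD (f g : T -> R) : P.-integrable setT (EFin \o f) ->
    P.-integrable setT (EFin \o g) -> P.-integrable setT (EFin \o fun w => f w + g w).
  by move=> fi gi; exact: (integrableD measurableT fi gi).
have j2 := iD _ _ (bL a b c (p + q + r)) (bL a b (- c) (p + q - r)).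
have j3 := iD _ _ j2 (bL a (- b) c (p - q + r)).
have j4 := iD _ _ j3 (bL a (- b) (- c) (p - q - r)).
rewrite RintegralZl// !RintegralD// !Rintegral_cos_lincomb.
rewrite Rintegral_cos1 Rintegral_cos2 Rintegral_cos3 !sqrrN.
rewrite (_ : - ((_ + _ + _) / 2) = - (a ^+ 2 * v1 / 2) + - (b ^+ 2 * v2 / 2)
  + - (c ^+ 2 * v3 / 2)); last by field.
rewrite !expRD; set e1 := expR _; set e2 := expR _; set e3 := expR _.
transitivity (cos p * (cos q * cos r) * (e1 * e2 * e3)); last by ring.
by rewrite cosM3; field.
Qed.

Lemma trig_poly_independent (f1 f2 f3 : R -> R) :
  trig_poly f1 -> trig_poly f2 -> trig_poly f3 ->
  \int[P]_w (f1 (X1 w) * (f2 (X2 w) * f3 (X3 w))) =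
  (\int[P]_w f1 (X1 w)) * ((\int[P]_w f2 (X2 w)) * (\int[P]_w f3 (X3 w))).
Proof.
move=> t1 t2 t3.
have b1 := bounded_var_trig_poly (measurable_funP X1) t1.
have b2 := bounded_var_trig_poly (measurable_funP X2) t2.
have bc2 b q := bounded_var_cos b q (measurable_funP X2).
have bc3 c r := bounded_var_cos c r (measurable_funP X3).
have step1 b q c r :
    \int[P]_w (f1 (X1 w) * (cos (b * X2 w + q) * cos (c * X3 w + r))) =
    (\int[P]_w f1 (X1 w)) *
    ((\int[P]_w cos (b * X2 w + q)) * (\int[P]_w cos (c * X3 w + r))).
  apply: trig_poly_factor => //; first exact: bounded_varM.
  by move=> a p; exact: Rintegral_cosM3.
have step2 c r :
    \int[P]_w (f2 (X2 w) * (f1 (X1 w) * cos (c * X3 w + r))) =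
    (\int[P]_w f2 (X2 w)) *
    ((\int[P]_w f1 (X1 w)) * (\int[P]_w cos (c * X3 w + r))).
  apply: trig_poly_factor => //; first exact: bounded_varM.
  move=> b q; rewrite mulrCA -step1.
  by apply: eq_Rintegral => w _; rewrite mulrCA.
have := @trig_poly_factor _ _ _ P X3 (fun w => f1 (X1 w) * f2 (X2 w))
  ((\int[P]_w f1 (X1 w)) * (\int[P]_w f2 (X2 w))) f3 (measurable_funP X3)
  (bounded_varM b1 b2).
move=> h; rewrite mulrA mulrC -h//.
  by apply: eq_Rintegral => w _; ring.
move=> c r; transitivity (\int[P]_w (f2 (X2 w) * (f1 (X1 w) * cos (c * X3 w + r)))).
  by apply: eq_Rintegral => w _; ring.
by rewrite step2; ring.
Qed.

End uncorrelated.

Section uncorrelated_independent.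
Context d (T : measurableType d) (R : realType) (P : probability T R).
Variables X1 X2 X3 : {RV P >-> R}.
Hypothesis gX : centered_gaussian_vector3 X1 X2 X3.
Hypothesis g1 : nondeg_centered_gaussian P X1.
Hypothesis g2 : nondeg_centered_gaussian P X2.
Hypothesis g3 : nondeg_centered_gaussian P X3.
Hypothesis c12 : \int[P]_w (X1 w * X2 w) = 0.
Hypothesis c13 : \int[P]_w (X1 w * X3 w) = 0.
Hypothesis c23 : \int[P]_w (X2 w * X3 w) = 0.

(** The expected product of three bumps has two limits: the probability of the box by dominated
    convergence, and the product of the marginals by factorisation before the limit. *)
Lemma itv_oo_independent (a1 b1 a2 b2 a3 b3 : R) : a1 < b1 -> a2 < b2 -> a3 < b3 ->
  P (X1 @^-1` `]a1, b1[ `&` (X2 @^-1` `]a2, b2[ `&` X3 @^-1` `]a3, b3[)) =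
  (P (X1 @^-1` `]a1, b1[) *
   (P (X2 @^-1` `]a2, b2[) * P (X3 @^-1` `]a3, b3[)))%E.
Proof.
move=> ab1 ab2 ab3.
pose A1 := X1 @^-1` `]a1, b1[; pose A2 := X2 @^-1` `]a2, b2[.
pose A3 := X3 @^-1` `]a3, b3[.
have mA1 : measurable A1 by exact: measurable_funPTI.
have mA2 : measurable A2 by exact: measurable_funPTI.
have mA3 : measurable A3 by exact: measurable_funPTI.
pose B (a b x : R) n : R := bump n ((x - (a + b) / 2) / ((b - a) / 2)).
have tB a b n : trig_poly (B a b ^~ n) by exact: trig_poly_bump.
have bB a b n x : `|B a b x n| <= 1.
  by have /andP[b0 b1'] := bump_itv n ((x - (a + b) / 2) / ((b - a) / 2));
    rewrite ger0_norm.
have mB (X : {RV P >-> R}) a b n : measurable_fun setT (fun w => B a b (X w) n).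
  by have [] := bounded_var_trig_poly (measurable_funP X) (tB a b n).
have mI (A : set T) : measurable A -> measurable_fun setT (\1_A : T -> R).
  by move=> mA; exact: measurable_indic.
have int1 : P.-integrable setT (EFin \o cst (1 : R)).
  exact: finite_measure_integrable_cst.
have lim1 (X : {RV P >-> R}) a b : a < b -> nondeg_centered_gaussian P X ->
    \int[P]_w B a b (X w) n @[n --> \oo] --> fine (P (X @^-1` `]a, b[)).
  move=> ab g; rewrite -Rintegral_indic; last exact: measurable_funPTI.
  apply: (@Rdominated_cvg _ _ R P (fun n w => B a b (X w) n) _ (cst 1)) => //.
  - by apply: mI; exact: measurable_funPTI.
  - have := nondeg_gaussian_ae_neq b g; have := nondeg_gaussian_ae_neq a g.
    by apply: filterS2 => w xa xb; exact: cvg_bump_itv.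
have ae2 (X : {RV P >-> R}) a b : nondeg_centered_gaussian P X ->
    {ae P, forall w, X w != a /\ X w != b}.
  move=> g; have := nondeg_gaussian_ae_neq b g.
  by have := nondeg_gaussian_ae_neq a g; apply: filterS2.
have lim3 : \int[P]_w (B a1 b1 (X1 w) n * (B a2 b2 (X2 w) n * B a3 b3 (X3 w) n))
    @[n --> \oo] --> fine (P (A1 `&` (A2 `&` A3))).
  rewrite -Rintegral_indic; last by do 2 apply: measurableI => //.
  apply: (@Rdominated_cvg _ _ R P (fun n w =>
    B a1 b1 (X1 w) n * (B a2 b2 (X2 w) n * B a3 b3 (X3 w) n)) _ (cst 1)) => //.
  - by move=> n; do 2 apply: measurable_funM => //.
  - by apply: mI; do 2 apply: measurableI => //.
  - apply: filterS3 (ae2 X1 a1 b1 g1) (ae2 X2 a2 b2 g2) (ae2 X3 a3 b3 g3).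
    move=> w [xa1 xb1] [xa2 xb2] [xa3 xb3].
    rewrite !indicI.
    exact: (cvgM (cvg_bump_itv ab1 xa1 xb1)
      (cvgM (cvg_bump_itv ab2 xa2 xb2) (cvg_bump_itv ab3 xa3 xb3))).
  - move=> n w; rewrite !normrM /=.
    by rewrite !mulr_ile1 ?mulr_ge0.
have lim3' : \int[P]_w (B a1 b1 (X1 w) n * (B a2 b2 (X2 w) n * B a3 b3 (X3 w) n))
    @[n --> \oo] --> fine (P A1) * (fine (P A2) * fine (P A3)).
  have -> : (fun n => \int[P]_w (B a1 b1 (X1 w) n *
      (B a2 b2 (X2 w) n * B a3 b3 (X3 w) n))) =
      (fun n => \int[P]_w B a1 b1 (X1 w) n *
        (\int[P]_w B a2 b2 (X2 w) n * \int[P]_w B a3 b3 (X3 w) n)).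
    apply/funext => n.
    exact: (trig_poly_independent gX c12 c13 c23 (tB _ _ n) (tB _ _ n) (tB _ _ n)).
  exact: cvgM (lim1 X1 _ _ ab1 g1) (cvgM (lim1 X2 _ _ ab2 g2) (lim1 X3 _ _ ab3 g3)).
have eq3 : fine (P (A1 `&` (A2 `&` A3))) =
    fine (P A1) * (fine (P A2) * fine (P A3)).
  exact: (cvg_unique _ lim3 lim3').
rewrite -/A1 -/A2 -/A3.
have fP (A : set T) : measurable A -> P A \is a fin_num.
  by move=> mA; exact: fin_num_measure.
rewrite -[LHS]fineK ?eq3; last by apply: fP; do 2 apply: measurableI => //.
by rewrite !EFinM !fineK//; exact: fP.
Qed.

Lemma uncorrelated_independent3 : independent3 X1 X2 X3.
Proof.
have mX (X : {RV P >-> R}) A : measurable A -> measurable (X @^-1` A).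
  by move=> mA; exact: measurable_funPTI.
have fP (A : set T) : measurable A -> P A \is a fin_num.
  by move=> mA; exact: fin_num_measure.
have pE (A : set T) : measurable A -> (fine (P A))%:E = P A.
  by move=> mA; rewrite fineK// fP.
have p0 (A : set T) : 0 <= fine (P A) by exact: fine_ge0.
have step1 a2 b2 a3 b3 A1 : a2 < b2 -> a3 < b3 -> measurable A1 ->
    P (X1 @^-1` A1 `&` (X2 @^-1` `]a2, b2[ `&` X3 @^-1` `]a3, b3[)) =
    (P (X1 @^-1` A1) * (P (X2 @^-1` `]a2, b2[) * P (X3 @^-1` `]a3, b3[)))%E.
  move=> ab2 ab3 mA1; have mI a b : measurable (`]a, b[%classic : set R) by [].
  rewrite -(pE _ (mX X2 _ (mI a2 b2))) -(pE _ (mX X3 _ (mI a3 b3))) -EFinM.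
  apply: preimage_itv_oo_factor => //.
  - by apply: measurableI; exact: mX.
  - exact: mulr_ge0.
  - move=> a b ab; rewrite EFinM (pE _ (mX X2 _ (mI a2 b2))).
    by rewrite (pE _ (mX X3 _ (mI a3 b3))); exact: itv_oo_independent.
have step2 A1 A2 a3 b3 : a3 < b3 -> measurable A1 -> measurable A2 ->
    P (X2 @^-1` A2 `&` (X1 @^-1` A1 `&` X3 @^-1` `]a3, b3[)) =
    (P (X2 @^-1` A2) * (P (X1 @^-1` A1) * P (X3 @^-1` `]a3, b3[)))%E.
  move=> ab3 mA1 mA2; have mI3 : measurable (`]a3, b3[%classic : set R) by [].
  rewrite -(pE _ (mX X1 _ mA1)) -(pE _ (mX X3 _ mI3)) -EFinM.
  apply: preimage_itv_oo_factor => //.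
  - by apply: measurableI; exact: mX.
  - exact: mulr_ge0.
  - move=> a b ab; rewrite EFinM (pE _ (mX X1 _ mA1)) (pE _ (mX X3 _ mI3)).
    by rewrite setICA step1// muleCA.
move=> A1 A2 A3 mA1 mA2 mA3; rewrite setIC [RHS]muleC.
rewrite -(pE _ (mX X1 _ mA1)) -(pE _ (mX X2 _ mA2)) -EFinM.
apply: preimage_itv_oo_factor => //.
- by apply: measurableI; exact: mX.
- exact: mulr_ge0.
- move=> a b ab; rewrite EFinM (pE _ (mX X1 _ mA1)) (pE _ (mX X2 _ mA2)).
  by rewrite setIC -setIA setICA step2// muleCA [RHS]muleC muleA.
Qed.

End uncorrelated_independent.

(** * The equality case *)

Lemma psd3_minors (R : realFieldType) (x y z : R) :
  (forall a b c, 0 <= a ^+ 2 + b ^+ 2 + c ^+ 2 +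
     2 * a * b * x + 2 * a * c * y + 2 * b * c * z) ->
  x ^+ 2 <= 1 /\ 0 <= 1 + 2 * x * y * z - x ^+ 2 - y ^+ 2 - z ^+ 2.
Proof.
(* With [det] the claimed quantity, the form takes the value
   [(1 - z^2) * det] at [(1 - z^2, y z - x, x z - y)]. *)
move=> Q; split; first by have := Q x (-1) 0; lra.
have [z1|z1] := ltP (z ^+ 2) 1.
  have d0 : 0 < 1 - z ^+ 2 by lra.
  rewrite -(pmulr_rge0 _ d0).
  have := Q (1 - z ^+ 2) (y * z - x) (x * z - y).
  by congr (_ <= _); ring.
have z1' : z ^+ 2 = 1.
  by apply/eqP; rewrite eq_le z1 andbT; have := Q 0 z (-1); lra.
(* When [z ^+ 2 = 1] the previous trial vector gives no information. The new one has value
   [- (x - y z)^2], so [x = y z] and the determinant is zero. *)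
have u0 : x - y * z = 0.
  apply/eqP; rewrite -sqrf_eq0 eq_le sqr_ge0 andbT.
  have := Q (- (x - y * z)) 1 (- z).
  have -> : (- (x - y * z)) ^+ 2 + 1 ^+ 2 + (- z) ^+ 2 +
    2 * - (x - y * z) * 1 * x + 2 * - (x - y * z) * - z * y + 2 * 1 * - z * z =
    1 - z ^+ 2 - (x - y * z) ^+ 2 by ring.
  by rewrite z1'; lra.
have xE : x = y * z by apply/eqP; rewrite -subr_eq0 u0.
by rewrite xE z1' exprMn z1'; have := z1'; nra.
Qed.

Section independent_moments.
Context d (T : measurableType d) (R : realType) (P : probability T R).

(** Uniqueness of the product measure identifies the joint law, and Tonelli's theorem separates the
    integrals. *)
Lemma independent_integralM (X Y : {RV P >-> R}) (f g : R -> \bar R) :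
  (forall A B : set R, measurable A -> measurable B ->
    P (X @^-1` A `&` Y @^-1` B) = (P (X @^-1` A) * P (Y @^-1` B))%E) ->
  measurable_fun [set: R] f -> measurable_fun [set: R] g ->
  (forall x, 0 <= f x)%E -> (forall x, 0 <= g x)%E ->
  (\int[P]_w (f (X w) * g (Y w)) =
   (\int[P]_w f (X w)) * (\int[P]_w g (Y w)))%E.
Proof.
move=> indep mf mg f0 g0.
have mXY : measurable_fun setT (fun w => (X w, Y w)).
  by apply: measurable_fun_pair; exact: measurable_funP.
pose Z : {mfun T >-> (R * R)%type} :=
  HB.pack (fun w => (X w, Y w)) (isMeasurableFun.Build _ _ _ _ _ mXY).
pose F (z : R * R) := (f z.1 * g z.2)%E.
have mF : measurable_fun [set: R * R] F.
  by apply: emeasurable_funM; [apply: (measurableT_comp mf)|apply: (measurableT_comp mg)].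
have F0 z : (0 <= F z)%E by exact: mule_ge0.
transitivity (\int[distribution P Z]_z F z)%E.
  by rewrite ge0_integral_distribution.
rewrite (eq_measure_integral (distribution P X \x distribution P Y)%E); last first.
  by move=> A mA _; apply/esym/product_measure_unique => // *; exact: indep.
rewrite fubini_tonelli1//.
under eq_integral => x _.
  rewrite /fubini_F /F /= ge0_integralZl//.
  over.
rewrite ge0_integralZr//; last exact: integral_ge0.
by rewrite !ge0_integral_distribution.
Qed.

End independent_moments.

Section gaussian_pair.
Context d (T : measurableType d) (R : realType) (P : probability T R).

(** The degree 4 analogue of [moment_8_10], comparing coefficients of [x^2]; the constant 8 is
    [2^2 * 2!]. *)
Lemma moment_2_2 (X W : T -> R) (v u q : R) :
  all_moments P X -> all_moments P W ->
  (forall x, measurable_fun [set: T] (fun w => W w + x * X w)) ->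
  (forall x, centered_gaussian_or_zero P (fun w => W w + x * X w)) ->
  (forall x, \int[P]_w ((W w + x * X w) ^+ 2) = q + 2 * u * x + v * x ^+ 2) ->
  \int[P]_w (X w ^+ 2 * W w ^+ 2) = v * q + 2 * u ^+ 2.
Proof.
move=> mX mW mY gY varY.
pose p := 8^-1 *: (q%:P + (2 * u) *: 'X + v *: 'X^2) ^+ 2.
pose c i := (\int[P]_w (1 * X w ^+ i * W w ^+ (4 - i))) /
   (i`!%:R * (4 - i)`!%:R).
have hc x : \sum_(i < 5) c i * x ^+ i = p.[x].
  rewrite -(moment_expansion 4 x (all_moments_cst P 1) mX mW).
  under eq_Rintegral do rewrite mul1r.
  have := gaussian_moment_even (mY x) (gY x) 2; rewrite varY => ->.
  rewrite /p hornerZ horner_exp !(hornerD, hornerC, hornerZ, hornerX, hornerXn).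
  by rewrite (_ : 2`! = 2%N)//; field.
have := coef_eq_of_horner hc (isT : (2 < 5)%N).
rewrite /p coefZ coef_trinomial_expn big_mkcond !big_nat_recl//= big_geq//=.
rewrite !subSS !subn0 /c (_ : (2`!%:R * (4 - 2)`!%:R : R) = 4); last first.
  by rewrite -natrM.
under eq_Rintegral do rewrite mul1r.
move: (Rintegral _ _ _) => e h.
have -> : e = 4 * (e / 4) by field.
by rewrite h !(bin0, bin1, binn) bin_small// muln0; field.
Qed.

Lemma nondeg_gaussian_variance_gt0 (X : {RV P >-> R}) :
  nondeg_centered_gaussian P X -> 0 < \int[P]_w (X w ^+ 2).
Proof.
move=> [s [s0 lawX]]; rewrite /Rintegral.
rewrite (integral_gaussian (measurable_funP X) lawX (g := fun x => x ^+ 2)); last first.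
  exact: measurable_funX.
have := integral_Xn_normal_pdf (lt0r_neq0 s0) 1; rewrite /Rintegral => ->.
under eq_integral do rewrite /= mul1r.
by rewrite integral_normal_pdf /= mulr1 mul1r exprn_gt0.
Qed.

(** The variance hypothesis makes [u] the covariance. Independence factorises [E (X^2 W^2)], which
    against [moment_2_2] leaves [2 u^2 = 0]. *)
Lemma independent_uncorrelated (X W : {RV P >-> R}) (u : R) :
  all_moments P X -> all_moments P W ->
  (forall x, centered_gaussian_or_zero P (fun w => W w + x * X w)) ->
  (forall x, \int[P]_w ((W w + x * X w) ^+ 2) =
     \int[P]_w (W w ^+ 2) + 2 * u * x + \int[P]_w (X w ^+ 2) * x ^+ 2) ->
  (forall A B : set R, measurable A -> measurable B ->
    P (X @^-1` A `&` W @^-1` B) = (P (X @^-1` A) * P (W @^-1` B))%E) ->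
  u = 0.
Proof.
move=> mX mW gY varY indep.
have mY x : measurable_fun setT (fun w => W w + x * X w).
  by apply: measurable_funD => //; exact: measurable_funM.
have := moment_2_2 mX mW mY gY varY.
have mSq : measurable_fun [set: R] (fun x : R => (x ^+ 2)%:E).
  by apply/measurable_EFinP; exact: measurable_funX.
rewrite /Rintegral; under eq_integral do rewrite EFinM.
rewrite (independent_integralM (f := fun x => (x ^+ 2)%:E)
  (g := fun x => (x ^+ 2)%:E) indep)//; try by move=> x; rewrite lee_fin sqr_ge0.
rewrite fineM; [|exact: integrable_fin_num (all_moments_integrable (all_momentsX 2 _))..].
by move=> h; apply/eqP; rewrite -sqrf_eq0; apply/eqP; lra.
Qed.

Lemma gaussian_moments468 (Y : T -> R) : measurable_fun [set: T] Y ->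
  centered_gaussian_or_zero P Y -> let v := \int[P]_w (Y w ^+ 2) in
  [/\ \int[P]_w (Y w ^+ 4) = 3 * v ^+ 2, \int[P]_w (Y w ^+ 6) = 15 * v ^+ 3
    & \int[P]_w (Y w ^+ 8) = 105 * v ^+ 4].
Proof.
move=> mY gY v; have rec := gaussian_moment_rec mY gY.
have e4 : \int[P]_w (Y w ^+ 4) = 3 * v ^+ 2 by rewrite rec -/v /=; ring.
have e6 : \int[P]_w (Y w ^+ 6) = 15 * v ^+ 3.
  by rewrite rec -/v /= e4; ring.
by split=> //; rewrite rec -/v /= e6; ring.
Qed.

End gaussian_pair.

Lemma sum_sqr3_le0 (R : realDomainType) (x y z : R) :
  x ^+ 2 + y ^+ 2 + z ^+ 2 <= 0 -> [/\ x = 0, y = 0 & z = 0].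
Proof.
move=> le0; have : x ^+ 2 + y ^+ 2 + z ^+ 2 == 0.
  by rewrite eq_le le0 !addr_ge0// sqr_ge0.
rewrite !paddr_eq0 ?addr_ge0 ?sqr_ge0// !sqrf_eq0.
by move=> /andP[/andP[/eqP-> /eqP->] /eqP->].
Qed.

(** Dividing by standard deviations turns nonnegativity of the form into the conditions of
    [isserlis864_lb]. The surplus of squared correlations there gives the equality case. *)
Lemma isserlis864_ge (R : rcfType) (v1 v2 v3 c12 c13 c23 : R) :
  0 < v1 -> 0 < v2 -> 0 < v3 ->
  (forall a b c, 0 <= a ^+ 2 * v1 + b ^+ 2 * v2 + c ^+ 2 * v3 +
     2 * a * b * c12 + 2 * a * c * c13 + 2 * b * c * c23) ->
  105 * v1 ^+ 4 * (15 * v2 ^+ 3) * (3 * v3 ^+ 2) <=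
    isserlis864 v1 v2 v3 c12 c13 c23 /\
  (isserlis864 v1 v2 v3 c12 c13 c23 =
     105 * v1 ^+ 4 * (15 * v2 ^+ 3) * (3 * v3 ^+ 2) <->
   [/\ c12 = 0, c13 = 0 & c23 = 0]).
Proof.
move=> v1_gt0 v2_gt0 v3_gt0 Q.
pose s1 := Num.sqrt v1; pose s2 := Num.sqrt v2; pose s3 := Num.sqrt v3.
have s1_gt0 : 0 < s1 by rewrite sqrtr_gt0.
have s2_gt0 : 0 < s2 by rewrite sqrtr_gt0.
have s3_gt0 : 0 < s3 by rewrite sqrtr_gt0.
have s1_neq0 := lt0r_neq0 s1_gt0; have s2_neq0 := lt0r_neq0 s2_gt0.
have s3_neq0 := lt0r_neq0 s3_gt0.
have v1E : v1 = s1 ^+ 2 by rewrite sqr_sqrtr// ltW.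
have v2E : v2 = s2 ^+ 2 by rewrite sqr_sqrtr// ltW.
have v3E : v3 = s3 ^+ 2 by rewrite sqr_sqrtr// ltW.
pose x := c12 / (s1 * s2); pose y := c13 / (s1 * s3); pose z := c23 / (s2 * s3).
have c12E : c12 = s1 * s2 * x by rewrite /x; field; rewrite s1_neq0 s2_neq0.
have c13E : c13 = s1 * s3 * y by rewrite /y; field; rewrite s1_neq0 s3_neq0.
have c23E : c23 = s2 * s3 * z by rewrite /z; field; rewrite s2_neq0 s3_neq0.
have [x1 det] : x ^+ 2 <= 1 /\ 0 <= 1 + 2 * x * y * z - x ^+ 2 - y ^+ 2 - z ^+ 2.
  apply: psd3_minors => a b c; have := Q (a / s1) (b / s2) (c / s3).
  rewrite v1E v2E v3E c12E c13E c23E; congr (_ <= _); field.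
  by rewrite s1_neq0 s2_neq0 s3_neq0.
have lb := isserlis864_lb x1 det; clear det.
pose k := s1 ^+ 8 * s2 ^+ 6 * s3 ^+ 4.
have k_gt0 : 0 < k by rewrite !mulr_gt0// exprn_gt0.
have -> : isserlis864 v1 v2 v3 c12 c13 c23 = k * isserlis864 1 1 1 x y z.
  by rewrite v1E v2E v3E c12E c13E c23E isserlis864_scale.
(* Indeed [4725 = 105 * 15 * 3], the product of the standard eighth, sixth and fourth moments. *)
have -> : 105 * v1 ^+ 4 * (15 * v2 ^+ 3) * (3 * v3 ^+ 2) = k * 4725.
  by rewrite v1E v2E v3E /k; ring.
have at0 : x = 0 -> y = 0 -> z = 0 -> isserlis864 1 1 1 x y z = 4725.
  by move=> -> -> ->; rewrite /isserlis864; ring.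
move: (isserlis864 _ _ _ _ _ _) lb at0 => M lb at0.
split.
  rewrite ler_pM2l//; apply: le_trans lb.
  by rewrite ler_peMr ?ler0n// lerDl !addr_ge0// sqr_ge0.
split=> [/(mulfI (lt0r_neq0 k_gt0)) e|[c12_0 c13_0 c23_0]]; last first.
  by rewrite at0// /x /y /z ?c12_0 ?c13_0 ?c23_0 mul0r.
have [x0 y0 z0] : [/\ x = 0, y = 0 & z = 0].
  apply: sum_sqr3_le0; move: lb.
  by rewrite e -[leRHS]mulr1 ler_pM2l ?ltr0n// gerDl.
by rewrite c12E c13E c23E x0 y0 z0 !mulr0.
Qed.

Theorem theorem3p1 (d : measure_display) (T : measurableType d) (R : realType)
  (P : probability T R) (X1 X2 X3 : {RV P >-> R}) :
  centered_gaussian_vector3 X1 X2 X3 ->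
  nondeg_centered_gaussian P X1 ->
  nondeg_centered_gaussian P X2 ->
  nondeg_centered_gaussian P X3 ->
  ('E_P[(fun w => (X1 w ^+ 8)%R)] * 'E_P[(fun w => (X2 w ^+ 6)%R)] * 'E_P[(fun w => (X3 w ^+ 4)%R)]
     <= 'E_P[(fun w => (X1 w ^+ 8 * X2 w ^+ 6 * X3 w ^+ 4)%R)])%E /\
  ('E_P[(fun w => (X1 w ^+ 8 * X2 w ^+ 6 * X3 w ^+ 4)%R)] =
     'E_P[(fun w => (X1 w ^+ 8)%R)] * 'E_P[(fun w => (X2 w ^+ 6)%R)] * 'E_P[(fun w => (X3 w ^+ 4)%R)]
   <-> independent3 X1 X2 X3)%E.
Proof.
move=> gX nd1 nd2 nd3.
have [m1 m2 m3] := gaussian_vector_all_moments gX.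
have [g1 g2 g3] := gaussian_vector_marginals gX.
have EE (f : T -> R) : all_moments P f -> 'E_P[f]%E = (\int[P]_w f w)%:E.
  move=> mf; rewrite unlock /Rintegral fineK//.
  exact: integrable_fin_num (all_moments_integrable mf).
rewrite (EE _ (all_momentsX 8 m1)) (EE _ (all_momentsX 6 m2)).
rewrite (EE _ (all_momentsX 4 m3)) (EE _ (all_momentsM (all_momentsM
  (all_momentsX 8 m1) (all_momentsX 6 m2)) (all_momentsX 4 m3))).
rewrite mixed_moment_864// -!EFinM lee_fin.
have [_ _ ->] := gaussian_moments468 (measurable_funP X1) g1.
have [_ -> _] := gaussian_moments468 (measurable_funP X2) g2.
have [-> _ _] := gaussian_moments468 (measurable_funP X3) g3.
have [] := isserlis864_ge (nondeg_gaussian_variance_gt0 nd1)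
  (nondeg_gaussian_variance_gt0 nd2) (nondeg_gaussian_variance_gt0 nd3)
  (c12 := \int[P]_w (X1 w * X2 w)) (c13 := \int[P]_w (X1 w * X3 w))
  (c23 := \int[P]_w (X2 w * X3 w)).
  (* The form is the second moment of a linear combination, hence nonnegative. *)
  move=> a b c; rewrite -(variance_lincomb gX).
  by apply: Rintegral_ge0 => w _; exact: sqr_ge0.
move=> ineq eqP'; split=> //; split=> [[/eqP'[c12 c13 c23]]|indep].
  exact: uncorrelated_independent3.
congr EFin; apply/eqP'.
(* Pairwise independence comes from taking the third event to be the whole space. *)
have mT := @measurableT _ R; have setTE (X : {RV P >-> R}) : X @^-1` setT = setT by [].
split.
- apply: (independent_uncorrelated m1 m2) => [x|x|A B mA mB].
  + have := gX x 1 0; congr centered_gaussian_or_zero.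
    by apply/funext => w; ring.
  + transitivity (\int[P]_w ((x * X1 w + 1 * X2 w + 0 * X3 w) ^+ 2)).
      by apply: eq_Rintegral => w _; ring.
    by rewrite (variance_lincomb gX); ring.
  + have := indep A B setT mA mB mT.
    by rewrite setTE setIT probability_setT mule1.
- apply: (independent_uncorrelated m1 m3) => [x|x|A B mA mB].
  + have := gX x 0 1; congr centered_gaussian_or_zero.
    by apply/funext => w; ring.
  + transitivity (\int[P]_w ((x * X1 w + 0 * X2 w + 1 * X3 w) ^+ 2)).
      by apply: eq_Rintegral => w _; ring.
    by rewrite (variance_lincomb gX); ring.
  + have := indep A setT B mA mT mB.
    by rewrite setTE setIT probability_setT mule1.
- apply: (independent_uncorrelated m2 m3) => [x|x|A B mA mB].
  + have := gX 0 x 1; congr centered_gaussian_or_zero.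
    by apply/funext => w; ring.
  + transitivity (\int[P]_w ((0 * X1 w + x * X2 w + 1 * X3 w) ^+ 2)).
      by apply: eq_Rintegral => w _; ring.
    by rewrite (variance_lincomb gX); ring.
  + have := indep setT A B mT mA mB.
    by rewrite setTE setTI probability_setT mul1e.
Qed.
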